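(* Let $d$ be a positive integer, let $W$ be a finite-dimensional complex vector space of dimension at least two, and let $r$ be a positive integer not more than the complex generic symmetric rank of $\mathsf{S}^d(W)$. Then the set of symmetric border rank-$r$ complex symmetric tensors $$\{A\in \mathsf{S}^d(W) : \overline{\operatorname{rank}}_{\mathsf{S}}(A)=r\}$$ is path-connected.
   Context: All topological statements use the Euclidean topology. $\mathsf{S}^d(W)\subseteq W^{\otimes d}$ is the space of symmetric $d$-tensors. For $A\in\mathsf{S}^d(W)$, $\operatorname{rank}_{\mathsf{S}}(A)$ is the least $r\in\{0,1,2,\dots\}$ such that $A=\sum_{i=1}^r v_i^{\otimes d}$ with $v_i\in W$. The symmetric border rank $\overline{\operatorname{rank}}_{\mathsf{S}}(A)$ is the least $r$ such that $A$ lies in the (Euclidean) closure of $\{B\in\mathsf{S}^d(W):\operatorname{rank}_{\mathsf{S}}(B)\le r\}$. The complex generic symmetric rank is the smallest $r$ such that this closure is all of $\mathsf{S}^d(W)$. *)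

(* Defs.v *)
From mathcomp Require Import all_boot all_order all_fingroup all_algebra.
From mathcomp Require Import complex.
From mathcomp Require Import all_classical all_reals all_analysis.

Set Implicit Arguments.
Unset Strict Implicit.
Unset Printing Implicit Defensive.

Import Order.TTheory GRing.Theory Num.Theory numFieldNormedType.Exports.

Local Open Scope classical_set_scope.
Local Open Scope ring_scope.
Local Open Scope complex_scope.

(* Any two points are joined by a path in S; the empty set is excluded, as in
   the convention that path-connected spaces are nonempty. *)
Definition path_connected (R : realType) (T : topologicalType) (S : set T) :
    Prop :=
  S !=set0 /\
  forall x y, S x -> S y ->
    exists gamma : R -> T,
      [/\ {within `[0, 1], continuous gamma},
          gamma 0 = x, gamma 1 = y &
          forall t, 0 <= t <= 1 -> S (gamma t)].

Definition is_least (P : nat -> Prop) (r : nat) : Prop :=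
  P r /\ forall s, P s -> (r <= s)%N.

Section SymmetricTensors.
Variables (R : realType) (W : vectType R[i]) (d : nat).

(* The d-th tensor power of W, as the space of coordinate hypermatrices with
   respect to the basis [vbasis fullv] of W.  The topology of pointwise
   convergence on this finite power of C is the Euclidean one; R[i]^o is R[i]
   with the topology of its modulus. *)
Definition tensor : Type :=
  {ptws {ffun 'I_d -> 'I_(\dim {:W})} -> R[i]^o}.

(* The tensor product of w 0, ..., w (d - 1). *)
Definition tprod (w : 'I_d -> W) : tensor :=
  fun k => \prod_(i < d) coord (vbasis {:W}) (k i) (w i).

Definition tpow (v : W) : tensor := tprod (fun=> v).

Definition sym_tensor : set tensor :=
  [set A | forall (s : {perm 'I_d}) (k : {ffun 'I_d -> 'I_(\dim {:W})}),
             A [ffun i => k (s i)] = A k].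

Definition sum_of_powers (A : tensor) (r : nat) : Prop :=
  exists v : 'I_r -> W, A = (fun k => \sum_(i < r) tpow (v i) k).

Definition is_sym_rank (A : tensor) (r : nat) : Prop :=
  is_least (sum_of_powers A) r.

Definition sym_rank_le (r : nat) : set tensor :=
  sym_tensor `&` [set B | exists2 s, is_sym_rank B s & (s <= r)%N].

(* The closure within the subspace of symmetric tensors. *)
Definition sym_rank_closure (r : nat) : set tensor :=
  sym_tensor `&` closure (sym_rank_le r).

Definition is_sym_border_rank (A : tensor) (r : nat) : Prop :=
  is_least (fun s => sym_rank_closure s A) r.

Definition is_generic_sym_rank (g : nat) : Prop :=
  is_least (fun s => sym_rank_closure s = sym_tensor) g.

(* [tprod] is multilinear and sends the tuples of basis vectors to the unit
   hypermatrices, so [tensor] with [tprod] is a tensor power of W. *)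
Lemma tprod_linear (w : 'I_d -> W) (j : 'I_d) (a : R[i]) (u v : W) k :
  let upd x := fun i => if i == j then x else w i in
  tprod (upd (a *: u + v)) k = a * tprod (upd u) k + tprod (upd v) k.
Proof.
move=> upd.
have E x : tprod (upd x) k =
    coord (vbasis {:W}) (k j) x *
    \prod_(i < d | i != j) coord (vbasis {:W}) (k i) (w i).
  rewrite /tprod (bigD1 j) //= /upd eqxx; congr (_ * _).
  by apply: eq_bigr => i /negPf ->.
rewrite !E linearD linearZ /=.
by rewrite mulrDl mulrA.
Qed.

Lemma tprod_basis (k l : {ffun 'I_d -> 'I_(\dim {:W})}) :
  tprod (fun i => (vbasis {:W})`_(k i)) l = (k == l)%:R.
Proof.
have fe : free (vbasis {:W}) := basis_free (vbasisP _).
rewrite /tprod; case: eqVneq => [<-|kl].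
  by rewrite big1 // => i _; rewrite coord_free // eqxx.
have [i kli] : exists i, k i != l i.
  apply/existsP; apply: contraR kl; rewrite negb_exists => /forallP h.
  by apply/eqP/ffunP => i; apply/eqP; have := h i; rewrite negbK.
rewrite (bigD1 i) //= coord_free //.
by move: kli; rewrite eq_sym => /negPf ->; rewrite mul0r.
Qed.

End SymmetricTensors.

(* Main.v *)
Require Import Defs.
From mathcomp Require Import all_boot all_order all_fingroup all_algebra.
From mathcomp Require Import complex.
From mathcomp Require Import all_classical all_reals all_analysis.
From mathcomp Require Import closed_field zify ring lra.

Set Implicit Arguments.
Unset Strict Implicit.
Unset Printing Implicit Defensive.

Import Order.TTheory GRing.Theory Num.Theory numFieldNormedType.Exports.

Local Open Scope classical_set_scope.
Local Open Scope ring_scope.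
Local Open Scope complex_scope.

(* Let S_r be the set of sums of r powers: a cone that is the image of a
   polynomial map.  Curve selection is the key point: a point w at which every
   polynomial vanishing on such a cone I vanishes is the endpoint of a continuous
   curve running in I.  For this, take a linear projection p to a space of minimal
   dimension such that |y| <= K |p(y)| on I; then p(I) is dense.  By elimination of
   quantifiers and the bound, the set of all (s, p(y), s.y), for y in I and s a
   linear form, agrees, over the complement of the zero set of some h(s, u), with
   the zero set of a polynomial F(s, u, T) monic in T with simple roots.  Choose s0
   separating w from the rest of its fibre, move from (s0, p(w)) along a line that
   meets h = 0 in finitely many points, lift the line to a continuous path of roots
   T starting at s0.w, and recover y_j = - (dF/ds_j) / (dF/dT).

   Consequently the Euclidean closure of S_r is the zero set of the polynomials
   vanishing on S_r.  A tensor of border rank r is thus joined to a point of S_r,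
   avoiding the closure of S_(r-1).  Two points of S_r outside that closure have
   parameters on a complex line, only finitely many points of which lie in the zero
   set of a suitable polynomial vanishing on S_(r-1), and these can be avoided. *)

(** * Polynomial functions and elimination *)

(** The difficulty sits at the endpoint: [w] may lie over a point where h vanishes whatever s is, so
    nothing like an implicit function theorem applies there and only a one-sided limit is available.
    The bound |y| <= K |p(y)| serves twice: it gives the normalized coefficients of the fibre
    equation polynomial growth, which forces them to be polynomials and the equation to be monic,
    and it keeps the lifted points bounded near the endpoint. The linear form s is a parameter for
    two reasons: s0 can be chosen once [w] is known, and the derivatives in s recover every
    coordinate from the single root T, so that one continuous root carries the whole point.
    Convergence of T to s0.w alone would not give convergence to [w]; the coordinates are also
    confined to shrinking neighbourhoods of a finite grid, on which s0 isolates [w]. Primality of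
    the vanishing ideal, which comes from the polynomial parametrization, stands in for
    irreducibility. Strata up to the generic rank are nonempty because closures that stop growing
    once never grow again. *)

Section PolynomialFunctions.
Variable C : numClosedFieldType.
Implicit Types (e : nat -> C) (n : nat).

(** Iterated univariate polynomials, last variable outermost, so that resultants, gcds and
    pseudo-division over an integral domain apply to the last variable. *)
Fixpoint mp n : idomainType :=
  if n is m.+1 then {poly mp m} : idomainType else (C : idomainType).

Fixpoint ev n e : {rmorphism mp n -> C} :=
  match n return {rmorphism mp n -> C} with
  | 0 => idfun
  | m.+1 => [the {rmorphism {poly mp m} -> C} of
               horner_eval (e m) \o map_poly (ev m e)]
  end.

Lemma evS n e (p : mp n.+1) : ev n.+1 e p = (map_poly (ev n e) p).[e n].
Proof. by []. Qed.

Lemma ev_ext n e e' : (forall i, (i < n)%N -> e i = e' i) -> ev n e =1 ev n e'.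
Proof.
elim: n => [|n IHn] h p //.
rewrite !evS h //; congr (_.[_]); apply: eq_map_poly.
by apply: IHn => i /ltnW; apply: h.
Qed.

Definition upd e n (x : C) : nat -> C := fun i => if i == n then x else e i.

Lemma ev_upd n e x (p : mp n.+1) :
  ev n.+1 (upd e n x) p = (map_poly (ev n e) p).[x].
Proof.
rewrite evS {2}/upd eqxx; congr (_.[_]); apply: eq_map_poly.
by apply: ev_ext => i; rewrite /upd; case: ltngtP.
Qed.

Lemma poly_nonroot_seq (p : {poly C}) (s : seq C) :
  p != 0 -> uniq s -> (size p <= size s)%N -> exists2 x, x \in s & p.[x] != 0.
Proof.
move=> p0 us sz; apply: contrapT => h.
have /(max_poly_roots p0)/(_ us): all (root p) s.
  apply/allP => x xs; rewrite rootE; apply: contrapT => /negP px.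
  by apply: h; exists x.
by rewrite ltnNge sz.
Qed.

Lemma poly_nonroot_near (p : {poly C}) (x0 d : C) : p != 0 -> 0 < d ->
  exists x, [/\ p.[x] != 0, x != x0 & `|x - x0| < d].
Proof.
move=> p0 d0; pose f (i : nat) : C := x0 + d / i.+2%:R.
have finj : injective f.
  move=> i j /addrI /(mulfI (lt0r_neq0 d0)) /invr_inj /eqP.
  by rewrite eqr_nat => /eqP [].
have [||x /mapP[i _ ->] px] := @poly_nonroot_seq p (map f (iota 0 (size p))) p0.
- by rewrite map_inj_uniq ?iota_uniq.
- by rewrite size_map size_iota.
exists (f i); split => //; rewrite /f.
  rewrite -subr_eq0 addrAC subrr add0r.
  by rewrite mulf_eq0 invr_eq0 pnatr_eq0 orbF lt0r_neq0.
rewrite addrAC subrr add0r ger0_norm; last first.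
  by rewrite divr_ge0 // ltW.
by rewrite ltr_pdivrMr ?ltr0n // ltr_pMr // ltr1n.
Qed.

Lemma poly_nonroot_large (p : {poly C}) (K : C) : p != 0 -> 0 <= K ->
  exists x, p.[x] != 0 /\ K < `|x|.
Proof.
move=> p0 K0; pose f (i : nat) : C := K + i.+1%:R.
have finj : injective f.
  by move=> i j /addrI /eqP; rewrite eqr_nat => /eqP [].
have [||x /mapP[i _ ->] px] := @poly_nonroot_seq p (map f (iota 0 (size p))) p0.
- by rewrite map_inj_uniq ?iota_uniq.
- by rewrite size_map size_iota.
exists (f i); split => //; rewrite ger0_norm ?addr_ge0 //.
by rewrite ltrDl ltr0n.
Qed.

Lemma poly_nonroot (p : {poly C}) : p != 0 -> exists x, p.[x] != 0.
Proof. by move=> p0; have [x []] := poly_nonroot_large p0 (lexx 0); exists x. Qed.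

Lemma ev_neq0 n (p : mp n) : p != 0 -> exists e, ev n e p != 0.
Proof.
elim: n p => [|n IHn] p p0; first by exists (fun=> 0).
have /IHn [e he] : lead_coef (p : {poly mp n}) != 0 by rewrite lead_coef_eq0.
have /poly_nonroot [x hx] : map_poly (ev n e) p != 0.
  by rewrite -lead_coef_eq0 lead_coef_map_eq.
by exists (upd e n x); rewrite ev_upd.
Qed.

Lemma ev_eq0 n (p : mp n) : (forall e, ev n e p = 0) -> p = 0.
Proof.
move=> h; apply/eqP; apply: contrapT => /negP /ev_neq0 [e].
by rewrite h eqxx.
Qed.

(** Polynomial functions stated directly on infinite environments. The inductive form gives closure
    properties cheaply and translates both to [mp N] and to first-order ring terms. *)
Inductive pfun (N : nat) : ((nat -> C) -> C) -> Prop :=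
| Pconst c : pfun N (fun=> c)
| Pvar i : (i < N)%N -> pfun N (fun e => e i)
| Padd f g : pfun N f -> pfun N g -> pfun N (fun e => f e + g e)
| Pmul f g : pfun N f -> pfun N g -> pfun N (fun e => f e * g e).

Lemma pfun_ext N f e e' :
  pfun N f -> (forall i, (i < N)%N -> e i = e' i) -> f e = f e'.
Proof.
by move=> pf h; elim: pf => [//|i /h //|? ? _ -> _ ->|? ? _ -> _ ->].
Qed.

Lemma pfun_eq N f g : pfun N f -> f =1 g -> pfun N g.
Proof. by move=> pf /funext <-. Qed.

Lemma pfun_sum N (I : Type) (s : seq I) (P : pred I) (F : I -> (nat -> C) -> C) :
  (forall i, P i -> pfun N (F i)) -> pfun N (fun e => \sum_(i <- s | P i) F i e).
Proof.
move=> h; elim: s => [|i s IHs].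
  by apply: (pfun_eq (Pconst N 0)) => e; rewrite big_nil.
case Pi : (P i).
  by apply: (pfun_eq (Padd (h i Pi) IHs)) => e; rewrite big_cons Pi.
by apply: (pfun_eq IHs) => e; rewrite big_cons Pi.
Qed.

Lemma pfun_prod N (I : Type) (s : seq I) (P : pred I) (F : I -> (nat -> C) -> C) :
  (forall i, P i -> pfun N (F i)) -> pfun N (fun e => \prod_(i <- s | P i) F i e).
Proof.
move=> h; elim: s => [|i s IHs].
  by apply: (pfun_eq (Pconst N 1)) => e; rewrite big_nil.
case Pi : (P i).
  by apply: (pfun_eq (Pmul (h i Pi) IHs)) => e; rewrite big_cons Pi.
by apply: (pfun_eq IHs) => e; rewrite big_cons Pi.
Qed.

Lemma pfun_exp N f k : pfun N f -> pfun N (fun e => f e ^+ k).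
Proof.
move=> pf; elim: k => [|k IHk]; first exact: Pconst.
by apply: (pfun_eq (Pmul pf IHk)) => e; rewrite exprS.
Qed.

Lemma pfun_comp N M f (g : nat -> (nat -> C) -> C) :
  pfun N f -> (forall i, (i < N)%N -> pfun M (g i)) ->
  pfun M (fun e => f (fun i => g i e)).
Proof.
move=> pf h; elim: pf => [c|i /h //|? ? _ h1 _ h2|? ? _ h1 _ h2].
- exact: Pconst.
- exact: (Padd h1 h2).
- exact: (Pmul h1 h2).
Qed.

Lemma pfunW N M f : (N <= M)%N -> pfun N f -> pfun M f.
Proof.
move=> NM pf; apply: (pfun_comp pf) => i iN.
by apply: Pvar; apply: leq_trans NM.
Qed.

Lemma pfun_ev N (p : mp N) : pfun N (fun e => ev N e p).
Proof.
elim: N p => [|n IHn] p; first exact: Pconst.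
have h : pfun n.+1 (fun e =>
    \sum_(i < size (p : {poly mp n})) ev n e (p : {poly mp n})`_i * e n ^+ i).
  apply: pfun_sum => i _; apply: Pmul; first exact: (pfunW (leqnSn n) (IHn _)).
  by apply: pfun_exp; apply: Pvar.
apply: (pfun_eq h) => e; rewrite evS (@horner_coef_wide _ (size (p : {poly mp n}))).
  by apply: eq_bigr => i _; rewrite coef_map.
exact: size_poly.
Qed.

Fixpoint mpC n : {rmorphism C -> mp n} :=
  match n return {rmorphism C -> mp n} with
  | 0 => idfun
  | m.+1 => [the {rmorphism C -> {poly mp m}} of polyC \o mpC m]
  end.

Lemma mpCS n c : mpC n.+1 c = (mpC n c)%:P :> {poly mp n}.
Proof. by []. Qed.

Lemma ev_mpC n e c : ev n e (mpC n c) = c.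
Proof. by elim: n => // n IHn; rewrite evS mpCS map_polyC hornerC. Qed.

Fixpoint mpX n (i : nat) : mp n :=
  match n return mp n with
  | 0 => 0
  | m.+1 => if i == m then 'X : {poly mp m} else (mpX m i)%:P
  end.

Lemma ev_mpX n e i : (i < n)%N -> ev n e (mpX n i) = e i.
Proof.
elim: n => // n IHn; rewrite ltnS leq_eqVlt => /orP[/eqP -> | lt].
  by rewrite /= eqxx /horner_eval /= map_polyX hornerX.
by rewrite /= ltn_eqF // /horner_eval /= map_polyC hornerC /= IHn.
Qed.

Lemma pfun_mp N f : pfun N f -> exists p : mp N, forall e, f e = ev N e p.
Proof.
elim=> [c|i iN|? ? _ [p hp] _ [q hq]|? ? _ [p hp] _ [q hq]].
- by exists (mpC N c) => e; rewrite ev_mpC.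
- by exists (mpX N i) => e; rewrite ev_mpX.
- by exists (p + q) => e; rewrite rmorphD hp hq.
- by exists (p * q) => e; rewrite rmorphM hp hq.
Qed.

(** [mp N] is a domain and evaluation over an infinite field is faithful. This makes the ideal of a
    polynomially parametrized set prime. *)
Lemma pfun_mul_eq0 N f g : pfun N f -> pfun N g ->
  (forall e, f e * g e = 0) -> (forall e, f e = 0) \/ (forall e, g e = 0).
Proof.
move=> /pfun_mp[p hp] /pfun_mp[q hq] h.
have /eqP : p * q = 0 by apply: ev_eq0 => e; rewrite rmorphM -hp -hq h.
rewrite mulf_eq0 => /orP[] /eqP z; [left|right] => e.
  by rewrite hp z rmorph0.
by rewrite hq z rmorph0.
Qed.

(** The offset [c] leaves the first [c] variables free for the coordinates of the image point, the
    parameters coming after them. *)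
Lemma pfun_term N f c : pfun N f ->
  exists2 t : GRing.term C, GRing.rterm t &
    forall e : seq C, GRing.eval e t = f (fun i => e`_(c + i)).
Proof.
elim=> [x|i iN|? ? _ [p rp hp] _ [q rq hq]|? ? _ [p rp hp] _ [q rq hq]].
- by exists (GRing.Const x).
- by exists (GRing.Var _ (c + i)).
- by exists (GRing.Add p q) => [|e] /=; rewrite ?rp ?rq ?hp ?hq.
- by exists (GRing.Mul p q) => [|e] /=; rewrite ?rp ?rq ?hp ?hq.
Qed.

Definition env (e : seq C) : nat -> C := fun i => e`_i.

Lemma term_mp n (t : GRing.term C) : GRing.rterm t ->
  exists p : mp n, forall e : seq C, size e = n -> GRing.eval e t = ev n (env e) p.
Proof.
elim: t => //= [i _|x _|k _|t1 IH1 t2 IH2 /andP[/IH1[p hp] /IH2[q hq]]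
  |t /[apply] -[p hp]|t IH k /IH[p hp]
  |t1 IH1 t2 IH2 /andP[/IH1[p hp] /IH2[q hq]]|t IH k /IH[p hp]].
- have [iN|Ni] := ltnP i n.
    by exists (mpX n i) => e _; rewrite ev_mpX.
  by exists 0 => e se; rewrite rmorph0 nth_default ?se.
- by exists (mpC n x) => e _; rewrite ev_mpC.
- by exists k%:R => e _; rewrite rmorph_nat.
- by exists (p + q) => e se; rewrite rmorphD hp // hq.
- by exists (- p) => e se; rewrite rmorphN hp.
- by exists (p *+ k) => e se; rewrite rmorphMn hp.
- by exists (p * q) => e se; rewrite rmorphM hp // hq.
- by exists (p ^+ k) => e se; rewrite rmorphXn hp.
Qed.

(** Only the zero pattern of finitely many polynomials is retained from a formula: this is the form
    in which constructibility is used. Fixing the size of the environments controls the variables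
    that read the default 0. *)
Lemma qf_atoms n (f : GRing.formula C) : GRing.qf_form f && GRing.rformula f ->
  exists L : seq (mp n), forall e e' : seq C, size e = n -> size e' = n ->
    (forall G, G \in L -> (ev n (env e) G == 0) = (ev n (env e') G == 0)) ->
    GRing.qf_eval e f = GRing.qf_eval e' f.
Proof.
elim: f => //=.
- by move=> b _; exists [::].
- move=> t1 t2 /andP[/(term_mp n)[p hp] /(term_mp n)[q hq]].
  exists [:: p - q] => e e' se se' /(_ (p - q)).
  rewrite !hp // !hq // !rmorphB !subr_eq0; apply.
  by rewrite mem_head.
- move=> f1 IH1 f2 IH2 /andP[/andP[a b] /andP[c d]].
  have [|L1 h1] := IH1; first by rewrite a.
  have [|L2 h2] := IH2; first by rewrite b.
  exists (L1 ++ L2) => e e' se se' h.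
  rewrite (h1 e e') // ?(h2 e e') // => G GL; apply: h; rewrite mem_cat GL ?orbT //.
- move=> f1 IH1 f2 IH2 /andP[/andP[a b] /andP[c d]].
  have [|L1 h1] := IH1; first by rewrite a.
  have [|L2 h2] := IH2; first by rewrite b.
  exists (L1 ++ L2) => e e' se se' h.
  rewrite (h1 e e') // ?(h2 e e') // => G GL; apply: h; rewrite mem_cat GL ?orbT //.
- move=> f1 IH1 f2 IH2 /andP[/andP[a b] /andP[c d]].
  have [|L1 h1] := IH1; first by rewrite a.
  have [|L2 h2] := IH2; first by rewrite b.
  exists (L1 ++ L2) => e e' se se' h.
  rewrite (h1 e e') // ?(h2 e e') // => G GL; apply: h; rewrite mem_cat GL ?orbT //.
- move=> f IH /IH[L h]; exists L => e e' se se' hL.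
  by rewrite (h e e').
Qed.

Fixpoint exists_from (c N : nat) (f : GRing.formula C) : GRing.formula C :=
  if N is N'.+1 then GRing.Exists c (exists_from c.+1 N' f) else f.

Lemma exists_from_rform c N f :
  GRing.rformula (exists_from c N f) = GRing.rformula f.
Proof. by elim: N c => //=. Qed.

Lemma holds_exists_from N f (e : seq C) :
  GRing.holds e (exists_from (size e) N f) <->
  exists2 x : seq C, size x = N & GRing.holds (e ++ x) f.
Proof.
elim: N e => [|N IHN] e /=.
  by split=> [h|[x /size0nil ->]]; [exists [::]|]; rewrite ?cats0.
have E x : set_nth 0 e (size e) x = rcons e x.
  by elim: e => //= a e ->.
split=> [[x]|[[//|x xs] [sx]]].
  rewrite E -(size_rcons e x) => /IHN[xs sx]; rewrite cat_rcons.
  by exists (x :: xs) => //=; rewrite sx.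
rewrite -cat_rcons => h; exists x; rewrite E -(size_rcons e x).
by apply/IHN; exists xs.
Qed.

Lemma graph_formula N n (psi : nat -> (nat -> C) -> C) m :
  (forall i, (i < m)%N -> pfun N (psi i)) ->
  exists2 f : GRing.formula C, GRing.rformula f & forall e : seq C,
    GRing.holds e f <->
    forall i, (i < m)%N -> e`_i = psi i (fun j => e`_(n + j)).
Proof.
elim: m => [|m IHm] h; first by exists (GRing.Bool true).
have [|f rf hf] := IHm; first by move=> i im; apply: h; rewrite ltnW.
have [t rt ht] := pfun_term n (h m (leqnn _)).
exists (GRing.And (GRing.Equal (GRing.Var C m) t) f) => [|e] /=.
  by rewrite rt.
rewrite ht; split=> [[em /hf ei] i|ei].
  by rewrite ltnS leq_eqVlt => /orP[/eqP -> //|/ei].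
by split; [exact: ei|apply/hf => i im; apply: ei; rewrite ltnW].
Qed.

(* Chevalley's theorem, obtained by eliminating the quantifiers over x. *)
Lemma image_constructible N n (psi : nat -> (nat -> C) -> C) :
  (forall i, (i < n)%N -> pfun N (psi i)) ->
  exists L : seq (mp n), forall e e' : nat -> C,
    (forall G, G \in L -> (ev n e G == 0) = (ev n e' G == 0)) ->
    (exists x, forall i, (i < n)%N -> e i = psi i x) ->
    (exists x, forall i, (i < n)%N -> e' i = psi i x).
Proof.
move=> hpsi; have [f0 rf0 hf0] := graph_formula n hpsi.
pose f := exists_from n N f0.
have rf : GRing.rformula f by rewrite exists_from_rform.
have im e : GRing.holds (mkseq e n) f <->
    exists x, forall i, (i < n)%N -> e i = psi i x.
  have se := size_mkseq e n.
  rewrite /f -[X in exists_from X]se holds_exists_from; split.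
    case=> x sx /hf0 h; exists (fun j => (mkseq e n ++ x)`_(n + j)) => i lin.
    by have := h i lin; rewrite nth_cat se lin nth_mkseq.
  case=> x h; exists (mkseq x N); first by rewrite size_mkseq.
  apply/hf0 => i lin; rewrite nth_cat se lin nth_mkseq // h //.
  apply: (pfun_ext (hpsi i lin)) => j jN.
  by rewrite nth_cat se ltnNge leq_addr /= addKn nth_mkseq.
have wf := GRing.quantifier_elim_wf (@ClosedFieldQE.wf_ex_elim C) rf.
have qe (e : seq C) := GRing.quantifier_elim_rformP (@ClosedFieldQE.wf_ex_elim C)
  (ClosedFieldQE.holds_ex_elim (@solve_monicpoly C)) e rf.
have [L hL] := qf_atoms n wf; exists L => e e' hee' /im /qe h.
apply/im/qe; rewrite -(hL (mkseq e n)) ?size_mkseq // => G GL.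
have evm g : ev n (env (mkseq g n)) =1 ev n g.
  by apply: ev_ext => i lin; rewrite /env nth_mkseq.
by rewrite !evm hee'.
Qed.

End PolynomialFunctions.

Arguments ev : simpl never.

(** * Limits, divisibility and Nagata's shift *)

Section Limits.
Variable C : numClosedFieldType.

(** Limits along an arbitrary filter, expressed by the modulus alone, so that they make sense over a
    closed field without a topology. A positive [eps] in [C] is automatically real. *)
Definition tends (D : Type) (F : set_system D) (f : D -> C) (l : C) : Prop :=
  forall eps, 0 < eps -> F [set x | `|f x - l| < eps].

Section Filtered.
Variables (D : Type) (F : set_system D).
Hypothesis FF : Filter F.
Implicit Types (f g : D -> C) (a b l : C).

Lemma tends_cst c : tends F (fun=> c) c.
Proof.
move=> eps e0; apply: filterS filterT => x _ /=.
by rewrite subrr normr0.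
Qed.

Lemma tends_near f g l : F [set x | f x = g x] -> tends F f l -> tends F g l.
Proof.
move=> fg fl eps e0; apply: filterS (filterI fg (fl eps e0)) => x [/= ->].
exact.
Qed.

Lemma tendsD f g a b :
  tends F f a -> tends F g b -> tends F (fun x => f x + g x) (a + b).
Proof.
move=> fa gb eps e0; have e2 : 0 < eps / 2 by rewrite divr_gt0.
apply: filterS (filterI (fa _ e2) (gb _ e2)) => x [/= h1 h2].
rewrite opprD addrACA (le_lt_trans (ler_normD _ _)) //.
by rewrite [ltRHS](splitr eps) ltrD.
Qed.

Lemma tendsM f g a b :
  tends F f a -> tends F g b -> tends F (fun x => f x * g x) (a * b).
Proof.
move=> fa gb eps e0.
pose M := 1 + `|a| + `|b| + eps.
have M0 : 0 < M by rewrite ltr_wpDl // !addr_ge0.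
have e1 : 0 < eps / M by rewrite divr_gt0.
have e2 : eps / M <= 1.
  by rewrite ler_pdivrMr // mul1r lerDr !addr_ge0.
apply: filterS (filterI (fa _ e1) (gb _ e1)) => x [/= h1 h2].
have -> : f x * g x - a * b = (f x - a) * (g x - b) + a * (g x - b) + b * (f x - a).
  by ring.
have lt1 : eps / M * (eps / M + `|a| + `|b|) < eps.
  rewrite -[ltRHS](divfK (lt0r_neq0 M0)) ltr_pM2l //.
  by rewrite (@le_lt_trans _ _ (1 + `|a| + `|b|)) ?lerD // ltrDl.
apply: le_lt_trans lt1; rewrite (le_trans (ler_normD _ _)) //.
rewrite [leRHS]mulrDr [in leRHS]mulrDr; apply: lerD; last first.
  by rewrite normrM mulrC ler_wpM2r // ltW.
rewrite (le_trans (ler_normD _ _)) //; apply: lerD; rewrite normrM.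
  by rewrite ler_pM // ltW.
by rewrite mulrC ler_wpM2r // ltW.
Qed.

Lemma tendsN f a : tends F f a -> tends F (fun x => - f x) (- a).
Proof.
by move=> fa eps /fa; apply: filterS => x /=; rewrite -opprD normrN.
Qed.

Lemma tendsB f g a b :
  tends F f a -> tends F g b -> tends F (fun x => f x - g x) (a - b).
Proof. by move=> fa gb; apply: tendsD => //; apply: tendsN. Qed.

Lemma tendsV f a : a != 0 -> tends F f a -> tends F (fun x => (f x)^-1) a^-1.
Proof.
move=> a0 fa eps e0; have na : 0 < `|a| by rewrite normr_gt0.
have d1 : 0 < `|a| / 2 by rewrite divr_gt0.
have d2 : 0 < eps * `|a| * (`|a| / 2) by rewrite !mulr_gt0.
apply: filterS (filterI (fa _ d1) (fa _ d2)) => x [/= h h'].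
have fx : `|a| / 2 <= `|f x|.
  rewrite -(lerD2l (`|a| / 2)) -splitr.
  have : `|a| <= `|a - f x| + `|f x|.
    by rewrite -{1}[a](subrK (f x)) ler_normD.
  by move=> /le_trans; apply; rewrite lerD2r distrC ltW.
have f0 : f x != 0.
  by rewrite -normr_gt0 (lt_le_trans _ fx) // divr_gt0.
have -> : (f x)^-1 - a^-1 = (a - f x) / (f x * a).
  by field; rewrite f0 a0.
rewrite normrM normfV ltr_pdivrMr; last by rewrite normr_gt0 mulf_neq0.
rewrite distrC (lt_le_trans h') //.
rewrite normrM -mulrA ler_pM2l // mulrC ler_pM2r //.
Qed.

Lemma tends_sum (I : Type) (s : seq I) (f : I -> D -> C) (l : I -> C) :
  (forall i, tends F (f i) (l i)) ->
  tends F (fun x => \sum_(i <- s) f i x) (\sum_(i <- s) l i).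
Proof.
move=> h; elim: s => [|i s IHs].
  rewrite big_nil; apply: tends_near (tends_cst 0).
  by apply: filterS filterT => x _ /=; rewrite big_nil.
rewrite big_cons; apply: tends_near (tendsD (h i) IHs).
by apply: filterS filterT => x _ /=; rewrite big_cons.
Qed.

Lemma tends_horner (p : {poly C}) f a :
  tends F f a -> tends F (fun x => p.[f x]) p.[a].
Proof.
move=> fa; elim/poly_ind: p => [|p c IHp].
  rewrite horner0; apply: tends_near (tends_cst 0).
  by apply: filterS filterT => x _ /=; rewrite horner0.
rewrite hornerMXaddC; apply: tends_near (tendsD (tendsM IHp fa) (tends_cst c)).
by apply: filterS filterT => x _ /=; rewrite hornerMXaddC.
Qed.

Lemma tends_pfun N (f : (nat -> C) -> C) (g : D -> nat -> C) (l : nat -> C) : pfun N f ->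
  (forall i, (i < N)%N -> tends F (fun x => g x i) (l i)) ->
  tends F (fun x => f (g x)) (f l).
Proof.
move=> pf h; elim: pf => [c|i /h //|? ? _ h1 _ h2|? ? _ h1 _ h2].
- exact: tends_cst.
- exact: tendsD.
- exact: tendsM.
Qed.

End Filtered.

Lemma tends_dominated (D : Type) (F : set_system D) (f g : D -> C) (K l : C) :
  ProperFilter F -> 0 <= K -> tends F f l -> tends F g 0 ->
  F [set x | `|f x| <= K * `|g x|] -> l = 0.
Proof.
move=> FF K0 fl g0 fg; apply/eqP; apply: contrapT => /negP l0.
have nl : 0 < `|l| by rewrite normr_gt0.
have K2 : 0 < K + 1 by rewrite ltr_wpDl.
have e0 : 0 < `|l| / (K + 1) by rewrite divr_gt0.
have [x [[/= h1 h2] h3]] := filter_ex (filterI (filterI (fl _ e0) (g0 _ e0)) fg).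
rewrite subr0 in h2.
suff : `|l| < `|l| by rewrite ltxx.
rewrite -{1}[l](subrK (f x)) (le_lt_trans (ler_normD _ _)) //.
rewrite -[ltRHS](divfK (lt0r_neq0 K2)) mulrDr mulr1 addrC ler_ltD //; last first.
  by rewrite distrC.
by rewrite (le_trans h3) // mulrC ler_wpM2r // ltW.
Qed.

(** The roots of [g] are removed because the estimates to be passed to the limit are only known off
    them. *)
Definition punctured (g : {poly C}) (x0 : C) : set_system C :=
  fun A => exists2 d, 0 < d &
    forall x, `|x - x0| < d -> g.[x] != 0 -> x != x0 -> A x.

Lemma punctured_proper g x0 : g != 0 -> ProperFilter (punctured g x0).
Proof.
move=> g0; split.
  move=> [d d0 h]; have [x [gx xx0 xd]] := poly_nonroot_near x0 g0 d0.
  exact: (h x).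
split.
- by exists 1.
- move=> P Q [d1 d10 h1] [d2 d20 h2].
  have /orP[le12|le21] : (d1 <= d2) || (d2 <= d1).
    by rewrite real_leVge // gtr0_real.
  + by exists d1 => // x xd gx xx; split; [apply: h1|apply: h2 => //; apply: lt_le_trans le12].
  + by exists d2 => // x xd gx xx; split; [apply: h1 => //; apply: lt_le_trans le21|apply: h2].
- by move=> P Q PQ [d d0 h]; exists d => // x xd gx xx; apply/PQ/h.
Qed.

Lemma tends_punctured g x0 : tends (punctured g x0) id x0.
Proof. by move=> eps e0; exists eps. Qed.

(* At a root of [a] the bound forces [r] to vanish, and the factor X - x0 can be
   removed from both. *)
Lemma dvdp_bounded (a r g : {poly C}) (kappa : C -> C) :
  a != 0 -> g != 0 ->
  (forall x0, exists K d : C, [/\ 0 <= K, 0 < d &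
     forall x, `|x - x0| < d -> kappa x <= K]) ->
  (forall x, g.[x] != 0 -> `|r.[x]| <= kappa x * `|a.[x]|) -> a %| r.
Proof.
move=> a0 g0 hk; have [n] := ubnP (size a); elim: n => // n IHn in a r g a0 g0 *.
rewrite ltnS => sa h; have [sa1|sa1] := leqP (size a) 1.
  have : size a == 1%N by rewrite eqn_leq sa1 size_poly_gt0.
  by move=> /size_poly1P[c c0 ->]; rewrite -alg_polyC dvdpZl ?dvd1p.
have [x0 /factor_theorem[a' ea]] : exists x0, root a x0.
  by apply/closed_rootP; rewrite neq_ltn sa1 orbT.
have [K [d [K0 d0 hK]]] := hk x0.
have PF := punctured_proper x0 g0.
have /factor_theorem[r' er] : root r x0.
  rewrite rootE; apply/eqP.
  have ta := tends_horner PF a (@tends_punctured g x0).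
  have tr := tends_horner PF r (@tends_punctured g x0).
  have ax : a.[x0] = 0 by rewrite ea hornerM hornerXsubC subrr mulr0.
  rewrite ax in ta; apply: (tends_dominated PF K0 tr ta).
  exists d => // x xd gx _ /=; rewrite (le_trans (h x gx)) // ler_wpM2r //.
  exact: hK.
have a'0 : a' != 0 by apply: contraNneq a0 => z; rewrite ea z mul0r.
rewrite ea er dvdp_mul2r ?polyXsubC_eq0 //.
(* After cancelling X - x0 the bound is known only away from [x0], so this point joins the
   exceptional set. *)
apply: (IHn a' r' (g * ('X - x0%:P))) => //.
- by rewrite mulf_neq0 ?polyXsubC_eq0.
- by rewrite ea size_Mmonic ?monicXsubC // size_XsubC addn2 in sa.
move=> x; rewrite hornerM hornerXsubC mulf_eq0 negb_or => /andP[gx xx].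
have := h x gx; rewrite ea er !hornerM hornerXsubC !normrM mulrA.
by rewrite ler_pM2r // normr_gt0.
Qed.

Lemma poly_bounded (p : {poly C}) (B : C) :
  exists2 M, 0 <= M & forall x, `|x| <= B -> `|p.[x]| <= M.
Proof.
have [B0|nB] := boolP (0 <= B); last first.
  by exists 0 => // x /(le_trans (normr_ge0 x)); rewrite (negPf nB).
exists (\sum_(i < size p) `|p`_i| * B ^+ i) => [|x xB].
  by apply: sumr_ge0 => i _; rewrite mulr_ge0 // exprn_ge0.
rewrite horner_coef (le_trans (ler_norm_sum _ _ _)) // ler_sum // => i _.
rewrite normrM normrX ler_wpM2l // lerXn2r // nnegrE //.
Qed.

End Limits.

(** * Division of polynomials in several variables *)

Section Shift.
Variable C : numClosedFieldType.
Implicit Type gam : nat -> {poly C}.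

(** The substitution x_i := x_i + gam_i(T), with T the outer variable of the result; [ev_shift] is
    its meaning on values. *)
Fixpoint shift n gam : {rmorphism mp C n -> {poly mp C n}} :=
  match n return {rmorphism mp C n -> {poly mp C n}} with
  | 0 => [the {rmorphism C -> {poly C}} of polyC]
  | m.+1 => [the {rmorphism {poly mp C m} -> {poly {poly mp C m}}} of
     horner_eval (('X)%:P + map_poly (mpC C m.+1) (gam m) : {poly {poly mp C m}})
       \o map_poly [the {rmorphism mp C m -> {poly {poly mp C m}}} of
            map_poly (@polyC (mp C m)) \o shift m gam]]
  end.

Lemma shiftS n gam (p : {poly mp C n}) :
  shift n.+1 gam p =
  (map_poly (map_poly (@polyC (mp C n)) \o shift n gam) p).[('X)%:P + map_poly (mpC C n.+1) (gam n)].
Proof. by []. Qed.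

Lemma shift_ext n gam gam' :
  (forall i, (i < n)%N -> gam i = gam' i) -> shift n gam =1 shift n gam'.
Proof.
elim: n => [|n IHn] h p //.
rewrite !shiftS h //; congr (_.[_]); apply: eq_map_poly => q /=.
by rewrite IHn // => i /ltnW; apply: h.
Qed.

Lemma ev_shift n gam e s (p : mp C n) :
  (map_poly (ev n e) (shift n gam p)).[s] =
  ev n (fun i => e i + (gam i).[s]) p.
Proof.
elim: n p => [|n IHn] p.
  by rewrite /= map_polyC hornerC.
have fC c : ev n.+1 e c%:P = ev n e c by rewrite evS map_polyC hornerC.
have fX : ev n.+1 e ('X : {poly mp C n}) = e n by rewrite evS map_polyX hornerX.
have fK c : ev n.+1 e (mpC C n.+1 c) = c := ev_mpC _ _ _.
rewrite shiftS evS; move: (ev n.+1 e) fC fX fK => f fC fX fK.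
rewrite -[LHS]/(horner_eval s (map_poly f _)) -horner_map -horner_map.
rewrite -!map_poly_comp; congr (_.[_]).
  apply: eq_map_poly => q; rewrite -IHn /= /horner_eval -map_poly_comp.
  by congr (_.[_]); apply: eq_map_poly => c; rewrite -fC.
rewrite /= /horner_eval rmorphD /= hornerD; congr (_ + _).
  by rewrite -fX map_polyC hornerC.
by rewrite -map_poly_comp map_poly_id // => c _ /=; exact: fK.
Qed.

Lemma shift0 n gam (p : mp C n) :
  (forall i, (gam i).[0] = 0) -> (shift n gam p).[0] = p.
Proof.
move=> g0; apply/eqP; rewrite -subr_eq0; apply/eqP/ev_eq0 => e.
rewrite rmorphB -horner_map rmorph0 ev_shift; apply/eqP; rewrite subr_eq0.
by apply/eqP/ev_ext => i _; rewrite g0 addr0.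
Qed.

(* Nagata's substitution: shifting the variables by rapidly growing powers of a
   new variable makes p monic in it, up to a constant. *)
Lemma shift_lead n (p : mp C n) : p != 0 ->
  exists gam (c : C), [/\ forall i, (gam i).[0] = 0, c != 0 &
    lead_coef (shift n gam p) = mpC C n c].
Proof.
elim: n p => [|n IHn] p p0.
  by exists (fun=> 0), p; split => // [i|]; rewrite ?horner0 //= lead_coefC.
have lp : lead_coef (p : {poly mp C n}) != 0 by rewrite lead_coef_eq0.
have [gam [c [g0 c0 lc]]] := IHn _ lp.
pose A j := map_poly (@polyC (mp C n)) (shift n gam (p : {poly mp C n})`_j).
have [N sN] : exists N, size (p : {poly mp C n}) = N.+1.
  by exists (size (p : {poly mp C n})).-1; rewrite prednK // size_poly_gt0.
have lN : lead_coef (p : {poly mp C n}) = (p : {poly mp C n})`_N by rewrite /lead_coef sN.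
have AN : lead_coef (A N) = mpC C n.+1 c.
  by rewrite /A -lN lead_coef_map_inj ?lc //; exact: polyC_inj.
have AN0 : (0 < size (A N))%N.
  by rewrite size_poly_gt0 -lead_coef_eq0 AN fmorph_eq0.
(* A size exceeds the degree by one, so [D] is above every degree in T of the [A j]: the terms of
   index j < N have degree below N D and cannot reach the top term. *)
pose D := (\max_(j < N.+1) size (A j))%N.
have AD j : (j <= N)%N -> (size (A j) <= D)%N.
  by move=> jN; rewrite /D (bigD1 (Ordinal (jN : (j < N.+1)%N))) //= leq_maxl.
have D0 : (0 < D)%N by rewrite (leq_trans AN0) ?AD.
pose gam' i := if i == n then 'X^D else gam i.
exists gam', c; split => // [i|].
  by rewrite /gam'; case: ifP => // _; rewrite hornerXn expr0n gtn_eqF.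
pose u : {poly {poly mp C n}} := ('X)%:P + 'X^D.
have lu : u \is monic by rewrite /u addrC monicXnaddC.
have su : size u = D.+1 by rewrite /u addrC size_XnaddC.
have -> : shift n.+1 gam' p = \sum_(j < N.+1) A j * u ^+ j.
  rewrite shiftS /gam' eqxx rmorphXn /= map_polyX.
  rewrite (@horner_coef_wide _ N.+1) -?sN ?size_poly //.
  apply: eq_bigr => j _; rewrite coef_map /=; congr (map_poly _ _ * _).
  by apply: shift_ext => i; case: ltngtP.
have suj j : size (u ^+ j) = (j * D).+1.
  elim: j => [|j IHj]; first by rewrite expr0 size_poly1.
  rewrite exprSr size_Mmonic //; last by rewrite -size_poly_gt0 IHj.
  by rewrite IHj su mulSn addnS /= addSn addnC.
have sAu j : (size (A j * u ^+ j)%R <= size (A j) + j * D)%N.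
  by rewrite (leq_trans (size_polyMleq _ _)) // suj addnS.
rewrite big_ord_recr /= addrC lead_coefDl.
  by rewrite lead_coef_Mmonic ?monic_exp.
rewrite size_Mmonic ?monic_exp -?size_poly_gt0 // suj addnS /=.
apply: (@leq_ltn_trans (N * D)%N); last by rewrite -[ltnLHS]add0n ltn_add2r.
apply: (leq_trans (size_sum _ _ _)); apply/bigmax_leqP => j _.
rewrite (leq_trans (sAu j)) // (@leq_trans (D + j * D)%N) //.
  by rewrite leq_add2r AD // ltnW.
by rewrite -mulSn leq_mul2r ltn_ord orbT.
Qed.

(** A quotient of polynomial growth is a polynomial. After Nagata's shift the divisor has a unit
    leading coefficient, so Euclidean division is possible; a nonzero remainder would, on a suitable
    line, be a multiple of a polynomial of larger degree by [dvdp_bounded]. Setting T = 0 undoes the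
    shift. *)
Lemma mp_dvd_bounded n (a b h : mp C n) (K : C) (k : nat) :
  a != 0 -> h != 0 -> 0 <= K ->
  (forall e, ev n e h != 0 ->
    `|ev n e b| <= K * (1 + \sum_(i < n) `|e i|) ^+ k * `|ev n e a|) ->
  exists c, b = c * a.
Proof.
move=> a0 h0 K0 hb; have [gam [c [g0 c0 lc]]] := shift_lead a0.
set a' := shift n gam a in lc; set b' := shift n gam b.
set h' := shift n gam h.
have h'0 : h' != 0.
  by apply: contraNneq h0 => z; rewrite -(shift0 h g0) -/h' z horner0.
have ul : lead_coef a' \is a GRing.unit.
  by rewrite lc rmorph_unit // unitfE.
have la0 : lead_coef a' != 0 by rewrite lc fmorph_eq0.
have eb := Pdiv.IdomainUnit.divp_eq ul b'.
set q := _ %/ _ in eb; set r := _ %% _ in eb.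
have sr : (size r < size a')%N by rewrite ltn_modp -lead_coef_eq0.
suff r0 : r = 0.
  exists q.[0]; rewrite -{1}(shift0 b g0) -{1}(shift0 a g0).
  by rewrite -/b' -/a' eb r0 addr0 hornerM.
apply/eqP; apply: contrapT => /negP r0.
(* At a point where this is nonzero the remainder keeps its degree and [h] does not vanish on the
   whole line. *)
have : lead_coef r * lead_coef h' != 0 by rewrite mulf_neq0 // lead_coef_eq0.
move=> /ev_neq0[e]; rewrite rmorphM mulf_eq0 negb_or => /andP[re he].
have ae : ev n e (lead_coef a') != 0 by rewrite lc ev_mpC.
pose f := map_poly (ev n e).
have dv : f a' %| f b'.
  pose kap s := K * (1 + \sum_(i < n) `|e i + (gam i).[s]|) ^+ k.
  apply: (@dvdp_bounded _ (f a') (f b') (f h') kap).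
  - by rewrite -lead_coef_eq0 /f lead_coef_map_eq.
  - by rewrite -lead_coef_eq0 /f lead_coef_map_eq.
  - move=> x0.
    have /choice[M hM] : forall i, exists M : C, 0 <= M /\
        forall x, `|x| <= `|x0| + 1 -> `|e i + (gam i).[x]| <= M.
      move=> i; have [M M0 hM] := poly_bounded ((e i)%:P + gam i) (`|x0| + 1).
      by exists M; split => // x /hM; rewrite hornerD hornerC.
    exists (K * (1 + \sum_(i < n) M i) ^+ k), 1; split => //.
      rewrite mulr_ge0 // exprn_ge0 // addr_ge0 // sumr_ge0 // => i _.
      by have [] := hM i.
    move=> x xd; rewrite ler_wpM2l // lerXn2r ?nnegrE ?addr_ge0 ?sumr_ge0 //.
      by move=> i _; have [] := hM i.
    rewrite lerD2l ler_sum // => i _; have [_] := hM i; apply.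
    rewrite -[x](subrK x0) addrC (le_trans (ler_normD _ _)) //.
    by rewrite lerD2l ltW.
  - by move=> x; rewrite /f !ev_shift => /hb.
have : f a' %| f r.
  move: dv; rewrite eb /f rmorphD rmorphM /= dvdp_addr //.
  by rewrite dvdp_mull.
move=> /dvdp_leq; rewrite -lead_coef_eq0 /f lead_coef_map_eq // => /(_ re).
by rewrite !size_map_poly_id0 // leqNgt sr.
Qed.

End Shift.

(** * Generic hypersurfaces *)

Lemma coef_prod_XsubC_le (C : numClosedFieldType) (rs : seq C) (B : C) :
  0 <= B -> (forall z, z \in rs -> `|z| <= B) ->
  forall j, `|(\prod_(z <- rs) ('X - z%:P))`_j| <= (1 + B) ^+ size rs.
Proof.
move=> B0; elim: rs => [|z rs IHrs] h j.
  rewrite big_nil coef1; case: (j == 0%N); by rewrite ?normr1 ?normr0.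
have {}IHrs := IHrs (fun y yrs => h y (@mem_behead _ (z :: rs) y yrs)).
rewrite big_cons mulrBl coefB coefXM coefCM (le_trans (ler_normB _ _)) //.
rewrite exprS mulrDl mul1r; apply: lerD.
  by case: ifP => // _; rewrite normr0 exprn_ge0 // addr_ge0.
by rewrite normrM ler_pM // h // mem_head.
Qed.

Section GenericHypersurface.
Variables (C : numClosedFieldType) (N k : nat) (psi : nat -> (nat -> C) -> C).
Variable K : C.
Hypothesis psi_pfun : forall i, (i < k.+1)%N -> pfun N (psi i).
Hypothesis K_ge0 : 0 <= K.
(** The square is for the later last coordinate s.y, which is bilinear in the linear form and the
    point. *)
Hypothesis psi_bound :
  forall x, `|psi k x| <= K * (1 + \sum_(i < k) `|psi i x|) ^+ 2.
Hypothesis psi_dense :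
  forall h : mp C k, (forall x, ev k (psi^~ x) h = 0) -> h = 0.

Let vanish (G : mp C k.+1) := forall x, ev k.+1 (psi^~ x) G = 0.

Let vanishM G1 G2 : vanish (G1 * G2) -> vanish G1 \/ vanish G2.
Proof.
have pf G : pfun N (fun x => ev k.+1 (psi^~ x) G).
  exact: (pfun_comp (pfun_ev G) psi_pfun).
move=> h; apply: (pfun_mul_eq0 (pf G1) (pf G2)) => x.
by rewrite -rmorphM.
Qed.

Let vanishC (c : mp C k) : vanish (c%:P : {poly mp C k}) -> c = 0.
Proof.
by move=> h; apply: psi_dense => x; have := h x; rewrite evS map_polyC hornerC.
Qed.

(** Otherwise, by constructibility, the image would contain every point off the zero set of some
    nonzero [h], in particular points with arbitrarily large last coordinate over a fixed base,
    against [psi_bound]. *)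
Let exists_vanish : exists2 G, G != 0 & vanish G.
Proof.
apply: contrapT => nG.
have van G : vanish G -> G = 0.
  by move=> vG; apply: contrapT => /eqP G0; apply: nG; exists G.
have [L hL] := image_constructible psi_pfun.
pose h : mp C k.+1 := \prod_(G <- L | G != 0) G.
have h0 : h != 0 by rewrite prodf_seq_neq0; apply/allP => G _; apply/implyP.
have [x0 hx0] : exists x, ev k.+1 (psi^~ x) h != 0.
  apply: contrapT => nx; move/eqP: h0; apply; apply: van => x.
  by apply: contrapT => /eqP hx; apply: nx; exists x.
have [b hb] : exists b, ev k b (lead_coef (h : {poly mp C k})) != 0.
  by apply: ev_neq0; rewrite lead_coef_eq0.
have hb0 : map_poly (ev k b) h != 0 by rewrite -lead_coef_eq0 lead_coef_map_eq.
have B0 : 0 <= K * (1 + \sum_(i < k) `|b i|) ^+ 2.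
  by rewrite mulr_ge0 // exprn_ge0 // addr_ge0 // sumr_ge0.
have [t [ht tB]] := poly_nonroot_large hb0 B0.
have [|x hx] := hL (psi^~ x0) (upd b k t) _ (ex_intro _ x0 (fun i _ => erefl)).
  have nz e : ev k.+1 e h != 0 -> forall G, G \in L -> (ev k.+1 e G == 0) = (G == 0).
    move=> he G GL; have [->|G0] := eqVneq G 0; first by rewrite rmorph0 eqxx.
    apply/negbTE; apply: contraNneq he => eG.
    rewrite /h (big_rem G) // G0 rmorphM mulf_eq0.
    by apply/orP; left; apply/eqP.
  move=> G GL; have ub : ev k.+1 (upd b k t) h != 0 by rewrite ev_upd.
  by rewrite (nz _ hx0 G GL) (nz _ ub G GL).
have := psi_bound x; rewrite -hx // {1}/upd eqxx.
have -> : \sum_(i < k) `|psi i x| = \sum_(i < k) `|b i|.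
  apply: eq_bigr => i _; rewrite -hx ?ltnS 1?ltnW // /upd.
  by rewrite (ltn_eqF (ltn_ord i)).
by move=> /(lt_le_trans tB); rewrite ltxx.
Qed.

Let minimal_vanish : exists F : {poly mp C k}, [/\ F != 0, vanish F &
  forall G : {poly mp C k}, vanish G -> (size G < size F)%N -> G = 0].
Proof.
pose P n := `[< exists F : {poly mp C k}, [/\ F != 0, vanish F & size F = n] >].
have exP : exists n, P n.
  have [G G0 vG] := exists_vanish.
  by exists (size (G : {poly mp C k})); apply/asboolP; exists G.
case: (ex_minnP exP) => n /asboolP[F [F0 vF sF]] minF.
exists F; split => // G vG sG; apply: contrapT => /eqP G0.
suff /minF : P (size G) by rewrite leqNgt -sF sG.
by apply/asboolP; exists G.
Qed.

Section Minimal.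
Variable F : {poly mp C k}.
Hypotheses (F_neq0 : F != 0) (F_vanish : vanish F).
Hypothesis F_min :
  forall G : {poly mp C k}, vanish G -> (size G < size F)%N -> G = 0.

Let F_size : (1 < size F)%N.
Proof.
rewrite ltnNge; apply/negP => sF; move: F_neq0; rewrite (size1_polyC sF).
have vc : vanish (F`_0)%:P by rewrite -size1_polyC.
by rewrite (vanishC vc) eqxx.
Qed.

Let vanishZ (c : mp C k) (G : {poly mp C k}) : c != 0 -> vanish (c *: G) -> vanish G.
Proof.
move=> c0; rewrite -mul_polyC => /vanishM[/vanishC|//] z.
by rewrite z eqxx in c0.
Qed.

(** The pseudo-remainder of [G] by [F] vanishes on the image and has smaller degree, so it is 0 by
    minimality. *)
Let vanish_root (G : {poly mp C k}) b t : vanish G ->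
  ev k b (lead_coef F) != 0 -> root (map_poly (ev k b) F) t ->
  (map_poly (ev k b) G).[t] = 0.
Proof.
move=> vG a0 /rootP rt.
have e := Pdiv.Idomain.divp_eq G F.
have r0 : G %% F = 0.
  apply: F_min; last by rewrite ltn_modp.
  have -> : G %% F = lead_coef F ^+ scalp G F *: G - G %/ F * F.
    by rewrite e addrAC subrr add0r.
  move=> x; rewrite -mul_polyC rmorphB !rmorphM.
  by rewrite vG F_vanish !mulr0 subrr.
have := congr1 (fun p => (map_poly (ev k b) p).[t]) e.
rewrite r0 addr0 -mul_polyC !rmorphM /= !hornerM rt mulr0 map_polyC hornerC.
have an : ev k b (lead_coef F ^+ scalp G F) != 0 by rewrite rmorphXn expf_neq0.
by move=> /eqP; rewrite mulf_eq0 => /orP[z|/eqP //]; rewrite z in an.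
Qed.

(** By primality a common factor of positive degree is impossible: either it would vanish on the
    image, and [G] with it, or the cofactor in [F] would, against minimality. Hence the resultant is
    nonzero. *)
Let not_vanish_bezout (G : {poly mp C k}) : ~ vanish G ->
  exists2 r : mp C k, r != 0 & exists U V : {poly mp C k}, r%:P = U * F + V * G.
Proof.
move=> nG; have [sG|sG] := leqP (size G) 1.
  exists G`_0; last by exists 0, 1; rewrite mul0r add0r mul1r -size1_polyC.
  apply/eqP => z; apply: nG => x.
  by rewrite (size1_polyC sG) z rmorph0.
have [[U V] _ e] := resultant_in_ideal F_size sG.
exists (resultant F G); last by exists U, V.
rewrite resultant_eq0 -leqNgt leqNgt; apply/negP => sD.
have /Pdiv.Idomain.dvdpP[[c E] /= c0 eF] := dvdp_gcdl F G.
have /Pdiv.Idomain.dvdpP[[c' E'] /= c'0 eG] := dvdp_gcdr F G.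
have D0 : gcdp F G != 0 by rewrite gcdp_eq0 (negPf F_neq0).
have : vanish (E * gcdp F G).
  by move=> x; rewrite -eF -mul_polyC rmorphM F_vanish mulr0.
case/vanishM => [vE|vD].
  have E0 : E != 0.
    apply: contraNneq F_neq0 => z.
    by rewrite -size_poly_eq0 -(size_scale F c0) eF z mul0r size_poly0.
  case/negP: (E0); apply/eqP; apply: F_min => //.
  have := congr1 (fun p : {poly mp C k} => size p) eF.
  rewrite size_scale // size_mul // => ->.
  by move: sD; case: (size (gcdp F G)) => [|[|m]] // _; rewrite !addnS /= ltnS leq_addr.
apply: nG; apply: (vanishZ c'0); rewrite eG => x.
by rewrite rmorphM vD mulr0.
Qed.

(** Minimality would make the derivative zero, which characteristic 0 excludes. *)
Let deriv_not_vanish : ~ vanish F^`().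
Proof.
move=> /F_min => /(_ (lt_size_deriv F_neq0)) z.
have [b hb] : exists b, ev k b (lead_coef F) != 0.
  by apply: ev_neq0; rewrite lead_coef_eq0.
have := congr1 (fun G : {poly mp C k} => ev k b G`_(size F).-2) z.
rewrite coef0 rmorph0 coef_deriv prednK; last by case: (size F) F_size => [|[|]].
rewrite rmorphMn => /eqP; rewrite mulrn_eq0 (negPf hb) orbF.
by case: (size F) F_size => [|[|]].
Qed.

(** [h] multiplies the Bezout constants of the derivative and of the elimination polynomials. Off
    its zero set, roots of [F] are simple and all have the same zero pattern as a generic image
    point, so constructibility puts them in the image. *)
Let generic_root : exists2 h : mp C k, h != 0 & forall b t,
  ev k b h != 0 -> ev k b (lead_coef F) != 0 -> root (map_poly (ev k b) F) t ->
  (exists x, (forall i, (i < k)%N -> psi i x = b i) /\ psi k x = t) /\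
  (map_poly (ev k b) F^`()).[t] != 0.
Proof.
have [L hL] := image_constructible psi_pfun.
have /choice[rr hrr] : forall G : {poly mp C k}, exists r : mp C k, r != 0 /\
    (~ vanish G -> exists U V : {poly mp C k}, r%:P = U * F + V * G).
  move=> G; have [vG|/not_vanish_bezout[r r0 hr]] := pselect (vanish G).
    by exists 1; split => //; rewrite oner_eq0.
  by exists r.
have nz (G : {poly mp C k}) b t : ~ vanish G -> ev k b (rr G) != 0 ->
    root (map_poly (ev k b) F) t -> (map_poly (ev k b) G).[t] != 0.
  move=> nG hr /rootP rt; have [_ /(_ nG)[U [V e]]] := hrr G.
  apply: contraNneq hr => Gt.
  have := congr1 (fun p => (map_poly (ev k b) p).[t]) e.
  rewrite map_polyC hornerC rmorphD !rmorphM /= hornerD !hornerM rt Gt.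
  by rewrite !mulr0 addr0 => ->.
pose h := rr F^`() * \prod_(G <- L) rr G.
have h0 : h != 0.
  rewrite mulf_neq0 //; first by case: (hrr F^`()).
  by rewrite prodf_seq_neq0; apply/allP => G _; case: (hrr G).
have hh b : ev k b h != 0 -> ev k b (rr F^`()) != 0 /\
    forall G, G \in L -> ev k b (rr G) != 0.
  rewrite rmorphM mulf_eq0 negb_or => /andP[-> hp]; split => // G GL.
  by apply: contraNneq hp => z; rewrite (big_rem G) // rmorphM z mul0r.
exists h => // b t hb ab rt; have [hd hg] := hh _ hb.
split; last by apply: nz => //; exact: deriv_not_vanish.
have [x0] : exists x, ev k (psi^~ x) (h * lead_coef F) != 0.
  apply: contrapT => nx.
  suff /eqP : h * lead_coef F = 0.
    by rewrite mulf_eq0 (negPf h0) lead_coef_eq0 (negPf F_neq0).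
  by apply: psi_dense => x; apply: contrapT => /eqP hx; apply: nx; exists x.
rewrite rmorphM mulf_eq0 negb_or => /andP[hx0 ax0].
have [_ hg0] := hh _ hx0.
have [|x hx] := hL (psi^~ x0) (upd b k t) _ (ex_intro _ x0 (fun i _ => erefl)).
  move=> G GL; rewrite ev_upd.
  have rx0 : root (map_poly (ev k (psi^~ x0)) F) (psi k x0).
    by rewrite rootE -evS F_vanish.
  have [vG|nG] := pselect (vanish G).
    by rewrite vG eqxx (vanish_root vG) ?eqxx.
  by rewrite evS (negPf (nz _ _ _ nG (hg _ GL) rt)) (negPf (nz _ _ _ nG (hg0 _ GL) rx0)).
exists x; split=> [i ik|]; last by rewrite -hx // /upd eqxx.
by rewrite -hx ?ltnS 1?ltnW // /upd (ltn_eqF ik).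
Qed.

(** Generic roots of [F] are values of [psi k], hence bounded by [psi_bound]; by Vieta the ratio of
    the two coefficients has polynomial growth, and [mp_dvd_bounded] applies. *)
Let lead_dvd j : exists c, F`_j = c * lead_coef F.
Proof.
have [h h0 hr] := generic_root.
have a0 : lead_coef F != 0 by rewrite lead_coef_eq0.
pose n := (size F).-1.
(* With roots at most K S^2 and S >= 1, coefficients are at most (1 + K S^2)^n <= (1 + K)^n
   S^(2n). *)
apply: (@mp_dvd_bounded _ _ _ _ (h * lead_coef F) ((1 + K) ^+ n) (2 * n)).
- by [].
- by rewrite mulf_neq0.
- by rewrite exprn_ge0 // addr_ge0.
move=> b; rewrite rmorphM mulf_eq0 negb_or => /andP[hb ab].
have [rs Frs] := closed_field_poly_normal (map_poly (ev k b) F).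
rewrite lead_coef_map_eq // in Frs.
have srs : size rs = n.
  have := congr1 (fun p : {poly C} => size p) Frs.
  rewrite size_scale // size_prod_XsubC size_map_poly_id0 // /n => ->.
  by [].
pose S := 1 + \sum_(i < k) `|b i|.
have S1 : 1 <= S by rewrite lerDl sumr_ge0.
have S0 : 0 <= S by rewrite (le_trans ler01).
have kap z : z \in rs -> `|z| <= K * S ^+ 2.
  move=> zrs; have rz : root (map_poly (ev k b) F) z.
    by rewrite Frs rootZ // root_prod_XsubC.
  have [[x [xb <-]] _] := hr b z hb ab rz.
  rewrite (le_trans (psi_bound x)) //; under eq_bigr do rewrite xb //.
  by [].
have -> : ev k b F`_j = (map_poly (ev k b) F)`_j by rewrite coef_map.
rewrite Frs coefZ normrM mulrC ler_wpM2r //.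
have KS : 0 <= K * S ^+ 2 by rewrite mulr_ge0 // exprn_ge0.
rewrite (le_trans (coef_prod_XsubC_le KS kap j)) // srs exprM -exprMn.
have le1 : 1 + K * S ^+ 2 <= (1 + K) * S ^+ 2.
  by rewrite mulrDl mul1r lerD2r exprn_ege1.
have p1 : 0 <= 1 + K * S ^+ 2 by rewrite addr_ge0.
by rewrite lerXn2r // nnegrE // (le_trans p1).
Qed.

Lemma monic_generator : exists (G : {poly mp C k}) (h : mp C k),
  [/\ G \is monic, h != 0, vanish G & forall b t,
    ev k b h != 0 -> root (map_poly (ev k b) G) t ->
    (exists x, (forall i, (i < k)%N -> psi i x = b i) /\ psi k x = t) /\
    (map_poly (ev k b) G^`()).[t] != 0].
Proof.
have [h h0 hr] := generic_root.
have a0 : lead_coef F != 0 by rewrite lead_coef_eq0.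
have /choice[c hc] := lead_dvd.
pose G : {poly mp C k} := \poly_(j < size F) c j.
have FG : F = lead_coef F *: G.
  apply/polyP => j; rewrite coefZ coef_poly; case: ltnP => [_|sj].
    by rewrite hc mulrC.
  by rewrite mulr0 nth_default.
have sG : size G = size F by rewrite [in RHS]FG size_scale.
exists G, (h * lead_coef F); split.
- rewrite monicE; have : lead_coef F = lead_coef F * lead_coef G.
    by rewrite -lead_coefZ -FG.
  by rewrite -{1}[lead_coef F]mulr1 => /(mulfI a0) <-.
- by rewrite mulf_neq0.
- by apply: (vanishZ a0); rewrite -FG.
move=> b t; rewrite rmorphM mulf_eq0 negb_or => /andP[hb ab] rt.
have evF : map_poly (ev k b) F = ev k b (lead_coef F) *: map_poly (ev k b) G.
  by rewrite [in LHS]FG -!mul_polyC rmorphM /= map_polyC.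
have [|xt dt] := hr b t hb ab; first by rewrite evF rootZ.
split => //; move: dt; rewrite -!deriv_map evF derivZ hornerZ mulf_eq0 negb_or.
by case/andP.
Qed.

End Minimal.

Lemma generic_hypersurface : exists (G : {poly mp C k}) (h : mp C k),
  [/\ G \is monic, h != 0, forall x, ev k.+1 (psi^~ x) G = 0 & forall b t,
    ev k b h != 0 -> root (map_poly (ev k b) G) t ->
    (exists x, (forall i, (i < k)%N -> psi i x = b i) /\ psi k x = t) /\
    (map_poly (ev k b) G^`()).[t] != 0].
Proof. by have [F [F0 vF minF]] := minimal_vanish; apply: (@monic_generator F). Qed.

End GenericHypersurface.

(** * Lifting paths of roots *)

Section PathLifting.
Variable R : realType.
Local Notation C := R[i].

Definition cts_on (A : set R) (f : R -> C) : Prop :=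
  forall t, A t -> tends (within A (nbhs t)) f (f t).

Lemma cts_on_setU A B f : closed A -> closed B -> cts_on A f -> cts_on B f ->
  cts_on (A `|` B) f.
Proof.
have half (D : set R) t (e : C) : closed D -> cts_on D f -> 0 < e ->
    \forall x \near t, D x -> `|f x - f t| < e.
  move=> cD fD e0; have [Dt|nDt] := pselect (D t).
    exact: (fD t Dt e e0).
  have oD : open_nbhs t (~` D) by split => //; apply: closed_openC.
  by apply: filterS (open_nbhs_nbhs oD) => x nDx /nDx.
move=> cA cB fA fB t _ e e0; rewrite /within /=.
have hA := half A t _ cA fA e0.
have hB := half B t _ cB fB e0.
by apply: filterS (filterI hA hB) => x [hAx hBx] [/hAx|/hBx].
Qed.

Lemma cts_on_ext A f g : (forall t, A t -> f t = g t) -> cts_on A f -> cts_on A g.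
Proof.
move=> fg fA t At e e0; have := fA t At e e0; rewrite /within /=.
by apply: filterS => x h Ax; rewrite -!fg //; apply: h.
Qed.

Lemma exists_le_norms (s : seq C) : all (fun z => z != 0) s ->
  exists2 rho : C, 0 < rho & forall z, z \in s -> rho <= `|z|.
Proof.
elim: s => [|z s IHs] /=; first by exists 1.
case/andP => z0 /IHs[r r0 hr].
have nz : 0 < `|z| by rewrite normr_gt0.
have /orP[le|le] : (r <= `|z|) || (`|z| <= r).
  by rewrite real_leVge // gtr0_real.
  by exists r => // y; rewrite inE => /orP[/eqP ->|/hr].
exists `|z| => // y; rewrite inE => /orP[/eqP ->|/hr] //.
exact: le_trans.
Qed.

Lemma exists_separation (s : seq C) :
  exists2 rho : C, 0 < rho & forall x y, x \in s -> y \in s ->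
    `|x - y| < rho + rho -> x = y.
Proof.
have [|r r0 hr] := @exists_le_norms
    [seq z <- [seq x - y | x <- s, y <- s] | z != 0].
  by apply/allP => z; rewrite mem_filter => /andP[].
exists (r / 2); first by rewrite divr_gt0.
rewrite -splitr => x y xs ys lt; apply/eqP; apply: contraTT lt => xy.
rewrite -real_leNgt ?normr_real ?(gtr0_real r0) //; apply: hr.
rewrite mem_filter subr_eq0 xy; by apply/allpairsP; exists (x, y).
Qed.

(** * Continuity of the roots of a monic family *)

Section Family.
Variables (G : R -> {poly C}) (n : nat).
Hypothesis G_monic : forall t, G t \is monic.
Hypothesis G_size : forall t, size (G t) = n.+1.

Lemma family_roots t : exists rs : seq C, size rs = n /\
  G t = \prod_(z <- rs) ('X - z%:P).
Proof.
have [rs e] := closed_field_poly_normal (G t).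
rewrite (monicP (G_monic t)) scale1r in e; exists rs; split => //.
by have := G_size t; rewrite e size_prod_XsubC => -[].
Qed.

(** The value is the product of the distances to the [n] roots, so one of them is below [e]. *)
Lemma small_value_root t z (e : C) : 0 < e -> `|(G t).[z]| < e ^+ n ->
  exists2 z', root (G t) z' & `|z' - z| < e.
Proof.
move=> e0 lt; have [rs [srs Grs]] := family_roots t.
apply: contrapT => h; move: lt; rewrite Grs horner_prod -srs => lt.
have : e ^+ size rs <= `|\prod_(y <- rs) ('X - y%:P).[z]|.
  have : forall y, y \in rs -> e <= `|z - y|.
    move=> y yrs; have : ~ (`|y - z| < e).
      by move=> ye; apply: h; exists y => //; rewrite Grs root_prod_XsubC.
    rewrite distrC => /negP; rewrite -real_leNgt //.
      exact: gtr0_real.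
  elim: (rs) => [|y s IHs] hs; first by rewrite big_nil normr1.
  rewrite big_cons normrM exprS hornerXsubC ler_pM //.
  - exact: ltW.
  - by rewrite exprn_ge0 // ltW.
  - by apply: hs; rewrite mem_head.
  - by apply: IHs => x xs; apply: hs; rewrite inE xs orbT.
by move=> /le_lt_trans/(_ lt); rewrite ltxx.
Qed.

Definition coef_cts t := forall i, tends (nbhs t) (fun s => (G s)`_i) (G t)`_i.

Lemma horner_cts t z : coef_cts t ->
  tends (nbhs t) (fun s => (G s).[z]) (G t).[z].
Proof.
move=> h; have -> : (fun s => (G s).[z]) =
    fun s => \sum_(i < n.+1) (G s)`_i * z ^+ i.
  by apply: funext => s; rewrite horner_coef G_size.
rewrite horner_coef G_size; apply: tends_sum => i.
by apply: tendsM => //; apply: tends_cst.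
Qed.

Lemma root_near t z (e : C) : coef_cts t -> root (G t) z -> 0 < e ->
  \forall s \near t, exists2 z', root (G s) z' & `|z' - z| < e.
Proof.
move=> ct /rootP rz e0; have en : 0 < e ^+ n by rewrite exprn_gt0.
have := horner_cts z ct en; rewrite rz; apply: filterS => s /=.
by rewrite subr0; apply: small_value_root.
Qed.

(** Converse of [root_near]: nearby roots are close to roots at [t]. The bound [B] makes the
    perturbation of values uniform in [z]. *)
Lemma roots_near t (B e : C) : coef_cts t -> 0 <= B -> 0 < e ->
  \forall s \near t, forall z, `|z| <= B -> root (G s) z ->
    exists2 z', root (G t) z' & `|z' - z| < e.
Proof.
move=> ct B0 e0; have en : 0 < e ^+ n by rewrite exprn_gt0.
have hd : tends (nbhs t)
    (fun s => \sum_(i < n.+1) `|(G s)`_i - (G t)`_i| * B ^+ i)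
    (\sum_(i < n.+1) 0 * B ^+ i).
  apply: tends_sum => i; apply: tendsM; last exact: tends_cst.
  move=> d d0; have := ct i d d0; apply: filterS => s /=.
  by rewrite subr0 normr_id.
have := hd _ en; apply: filterS => s /=.
rewrite [X in _ - X]big1 => [|i _]; last by rewrite mul0r.
rewrite subr0 => lt z zB /rootP rz; apply: small_value_root => //.
apply: le_lt_trans lt; rewrite [leRHS]ger0_norm; last first.
  by apply: sumr_ge0 => i _; rewrite mulr_ge0 // exprn_ge0.
have -> : (G t).[z] = - \sum_(i < n.+1) ((G s)`_i - (G t)`_i) * z ^+ i.
  under eq_bigr do rewrite mulrBl.
  by rewrite sumrB -(G_size s) -horner_coef rz (G_size s) -(G_size t) -horner_coef sub0r opprK.
rewrite normrN (le_trans (ler_norm_sum _ _ _)) // ler_sum // => i _.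
by rewrite normrM normrX ler_wpM2l // lerXn2r // nnegrE.
Qed.

Definition simple_roots t := forall z, root (G t) z -> (G t)^`().[z] != 0.

Lemma near_all_seq (D : Type) (T : eqType) (F : set_system D) (s : seq T)
    (P : T -> D -> Prop) :
  Filter F -> (forall x, x \in s -> F [set t | P x t]) ->
  F [set t | forall x, x \in s -> P x t].
Proof.
move=> FF; elim: s => [|x s IHs] h; first by apply: filterS filterT => t _ x.
have h1 := h x (mem_head _ _).
have h2 := IHs (fun y ys => h y (@mem_behead _ (x :: s) y ys)).
by apply: filterS (filterI h1 h2) => t [/= p q] y; rewrite inE => /orP[/eqP ->|/q].
Qed.

Lemma uniq_simple_roots (rs : seq C) :
  (forall z, z \in rs -> (\prod_(y <- rs) ('X - y%:P))^`().[z] != 0) -> uniq rs.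
Proof.
elim: rs => [|x rs IHrs] //= h; rewrite IHrs ?andbT.
  apply/negP => xrs; have := h x (mem_head _ _).
  rewrite big_cons derivM derivXsubC mul1r hornerD hornerM hornerXsubC subrr.
  by rewrite mul0r addr0 -[_ == 0]rootE root_prod_XsubC xrs.
move=> z zrs; have := h z; rewrite inE zrs orbT => /(_ isT).
rewrite big_cons derivM derivXsubC mul1r hornerD hornerM.
have -> : (\prod_(y <- rs) ('X - y%:P)).[z] = 0.
  by apply/rootP; rewrite root_prod_XsubC.
by rewrite add0r; apply: contraNneq => ->; rewrite mulr0.
Qed.

Lemma near_dist (t : R) (P : set R) : (\forall s \near t, P s) <->
  exists2 d : R, 0 < d & forall s, `|s - t| < d -> P s.
Proof.
rewrite -nbhs_nearE nbhs_ballP; split=> -[d d0 h]; exists d => // s.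
  by move=> sd; apply: h; rewrite /ball /= distrC.
by rewrite /ball /= distrC => /h.
Qed.

Lemma pos_min (a b : C) : 0 < a -> 0 < b ->
  exists c : C, [/\ 0 < c, c <= a & c <= b].
Proof.
move=> a0 b0; have /orP[le|le] : (a <= b) || (b <= a).
- by rewrite real_leVge // gtr0_real.
- by exists a.
- by exists b.
Qed.

(* Around a parameter with simple roots the n disjoint balls around these roots
   contain exactly one root each. *)
Lemma local_section t1 : simple_roots t1 -> (\forall t \near t1, coef_cts t) ->
  exists2 d : R, 0 < d & forall t2 z2, `|t2 - t1| < d -> root (G t2) z2 ->
    exists2 f : R -> C, f t2 = z2 & forall s, `|s - t1| < d ->
      root (G s) (f s) /\ tends (nbhs s) f (f s).
Proof.
move=> st1 nct; have ct1 : coef_cts t1 by exact: nbhs_singleton nct.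
have [rs [srs Grs]] := family_roots t1.
have inrs z : (z \in rs) = root (G t1) z by rewrite Grs root_prod_XsubC.
have urs : uniq rs.
  by apply: uniq_simple_roots => z; rewrite inrs -Grs; apply: st1.
have [rho rho0 sep] := exists_separation rs.
have nr : \forall s \near t1, forall z, z \in rs ->
    exists2 z', root (G s) z' & `|z' - z| < rho.
  apply: near_all_seq => z; rewrite inrs => rz; exact: root_near.
have [d d0 hd] := (near_dist _ _).1 (filterI nr nct).
have /choice[g hg] : forall p : R * C, exists z', `|p.1 - t1| < d ->
    p.2 \in rs -> root (G p.1) z' /\ `|z' - p.2| < rho.
  move=> [s z] /=; have [/hd[/= h _]|ns] := pselect (`|s - t1| < d); last by exists 0.
  have [/h[z' rz' lz']|nz] := boolP (z \in rs); first by exists z'.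
  by exists 0.
have gsep s z z' z'' : `|s - t1| < d -> z \in rs -> z' \in rs ->
    `|z'' - z| < rho -> `|z'' - z'| < rho -> z = z'.
  move=> sd zrs zrs' h h'; apply: sep => //.
  have -> : z - z' = (z'' - z') - (z'' - z) by ring.
  by rewrite (le_lt_trans (ler_normB _ _)) // ltrD.
(* The [n] roots picked in the disjoint balls are distinct, so they exhaust the list of [n]
   roots. *)
have cover s z' : `|s - t1| < d -> root (G s) z' ->
    exists2 z, z \in rs & z' = g (s, z).
  move=> sd; have [rs' [srs' Grs']] := family_roots s.
  rewrite Grs' root_prod_XsubC => z'rs.
  have um : uniq [seq g (s, z) | z <- rs].
    rewrite map_inj_in_uniq // => z1 z2 h1 h2 e.
    have [_ l1] := hg (s, z1) sd h1; have [_ l2] := hg (s, z2) sd h2.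
    by rewrite -e in l2; apply: (gsep s _ _ _ sd h1 h2 l1 l2).
  have sub : {subset [seq g (s, z) | z <- rs] <= rs'}.
    move=> y /mapP[z zrs ->]; have [] := hg (s, z) sd zrs.
    by rewrite Grs' root_prod_XsubC.
  have sle : (size rs' <= size [seq g (s, z) | z <- rs])%N.
    by rewrite size_map srs srs'.
  have [_ eqm] := uniq_min_size um sub sle.
  by move: z'rs; rewrite -eqm => /mapP[z zrs ->]; exists z.
have uni s z z' : `|s - t1| < d -> z \in rs -> root (G s) z' ->
    `|z' - z| < rho -> z' = g (s, z).
  move=> sd zrs rz' lz; have [z1 z1rs e] := cover s z' sd rz'.
  have [_ l1] := hg (s, z1) sd z1rs; rewrite -e in l1.
  by rewrite (gsep s z z1 z' sd zrs z1rs lz l1).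
exists d => // t2 z2 t2d rz2; have [z zrs ez] := cover _ _ t2d rz2.
exists (fun s => g (s, z)) => // s sd; have [rg lg] := hg (s, z) sd zrs.
split => // e e0.
(* Within this radius a root close to [g (s, z)] is still in the ball around [z], and is therefore
   the one picked there. *)
have l0 : 0 < rho - `|g (s, z) - z| by rewrite subr_gt0.
have [c [c0 ce cl]] := pos_min e0 l0.
have [_ cts] := hd s sd.
have nd : \forall x \near s, `|x - t1| < d.
  apply/near_dist; exists (d - `|s - t1|); first by rewrite subr_gt0.
  move=> x h; rewrite -[x](subrK s) -addrA (le_lt_trans (ler_normD _ _)) //.
  by rewrite -ltrBrDr.
apply: filterS (filterI nd (root_near cts rg c0)) => x [xd [z' rz' lz']] /=.
have -> : g (x, z) = z'.
  apply/esym/uni => //; rewrite -[z'](subrK (g (s, z))) -addrA.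
  by rewrite (le_lt_trans (ler_normD _ _)) // -ltrBrDr (lt_le_trans lz').
exact: lt_le_trans ce.
Qed.

Definition section_on (A : set R) (f : R -> C) :=
  cts_on A f /\ forall t, A t -> root (G t) (f t).

Lemma section_glue a c b f g : a <= c -> c <= b -> f c = g c ->
  section_on `[a, c]%classic f -> section_on `[c, b]%classic g ->
  section_on `[a, b]%classic (fun t => if t <= c then f t else g t).
Proof.
move=> ac cb fg [cf rf] [cg rg].
have E : `[a, b]%classic = `[a, c]%classic `|` `[c, b]%classic.
  apply/seteqP; split=> x /=; rewrite !in_itv /=.
    by move=> /andP[h1 h2]; have [h|/ltW h] := leP x c; [left|right]; rewrite ?h1 ?h2 ?h.
  case=> /andP[h1 h2]; first by rewrite h1 (le_trans h2).
  by rewrite h2 (le_trans ac).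
split.
  rewrite E; apply: cts_on_setU; try exact: interval_closed.
    by apply: cts_on_ext cf => t /=; rewrite in_itv /= => /andP[_ ->].
  apply: cts_on_ext cg => t /=; rewrite in_itv /= => /andP[h _].
  by case: leP => // h'; have -> : t = c by apply/le_anti; rewrite h h'.
move=> t /=; rewrite in_itv /= => /andP[h1 h2]; case: leP => h.
  by apply: rf; rewrite /= in_itv /= h1.
by apply: rg; rewrite /= in_itv /= ltW.
Qed.

(** Let [c] be the supremum of the reachable endpoints. The local section at [c] can start at any
    root over a reachable [c'] near [c], so it extends the lift beyond [c] unless [b] is reached. *)
Lemma section_itv a b z :
  a <= b -> (forall t, a <= t <= b ->
    simple_roots t /\ \forall s \near t, coef_cts s) ->
  root (G a) z -> exists2 f, f a = z & section_on `[a, b]%classic f.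
Proof.
move=> ab hG rz.
pose S := [set c | a <= c <= b /\ exists2 f, f a = z & section_on `[a, c]%classic f].
have Sa : S a.
  split; first by rewrite lexx.
  exists (fun=> z) => //; split=> [t _|t /=]; first exact: tends_cst.
  by rewrite in_itv /= => /le_anti <-.
have Sb : has_ubound S by exists b => c [/andP[]].
have hS : has_sup S by split; first by exists a.
pose c := sup S.
have ac : a <= c by apply: ub_le_sup.
have cb : c <= b by apply: ge_sup; [exists a|move=> x [/andP[]]].
have [|sc ncc] := hG c; first by rewrite ac.
have [d d0 hd] := local_section sc ncc.
have [c' Sc' cc'] := sup_adherent d0 hS.
have c'c : c' <= c by apply: ub_le_sup.
have [/andP[ac' _] [f fa sf]] := Sc'.
have c'd : `|c' - c| < d.
  by rewrite distrC ger0_norm ?subr_ge0 // ltrBlDr addrC -ltrBlDr.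
have rfc : root (G c') (f c') by apply: sf.2; rewrite /= in_itv /= ac' lexx.
have [g gc hg] := hd c' (f c') c'd rfc.
have ext e : c' <= e -> e < c + d -> e <= b -> S e.
  move=> c'e ed eb; split; first by rewrite (le_trans ac').
  exists (fun t => if t <= c' then f t else g t); first by rewrite ac'.
  apply: section_glue => //.
  have inn t : t \in `[c', e] -> `|t - c| < d.
    rewrite in_itv /= => /andP[h1 h2]; rewrite ltr_norml.
    rewrite ltrBlDr (addrC d) (le_lt_trans h2) // andbT ltrBrDr addrC.
    exact: lt_le_trans h1.
  split=> t /= /inn td; have [rt ct] := hg t td => //.
  move=> eps eps0; rewrite /within /=.
  by apply: filterS (ct eps eps0).
suff [] : S b by [].
apply: (ext) => //; first exact: le_trans cb.
rewrite ltNge; apply/negP => cdb.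
have d2 : 0 < d / 2 by rewrite divr_gt0.
have : S (c + d / 2).
  apply: ext.
  - by rewrite (le_trans c'c) // lerDl ltW.
  - by rewrite ltrD2l ltr_pdivrMr // ltr_pMr // ltr1n.
  - by rewrite (le_trans _ cdb) // lerD2l ler_pdivrMr // ler_peMr ?ler1n // ltW.
move=> /(ub_le_sup Sb); rewrite -/c leNgt => /negP; apply.
by rewrite ltrDl.
Qed.

(** The ray models a half-open interval whose missing end, where roots may collide, is sent to
    infinity. The lift is glued from unit intervals. *)
Lemma section_ray z :
  (forall t, 0 <= t -> simple_roots t /\ \forall s \near t, coef_cts s) ->
  root (G 0) z -> exists2 f, f 0 = z & section_on [set t | 0 <= t] f.
Proof.
move=> hG rz.
have /choice[E hE] : forall p : nat * C, exists f, root (G p.1%:R) p.2 ->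
    f p.1%:R = p.2 /\ section_on `[p.1%:R, p.1.+1%:R]%classic f.
  move=> [k y] /=; have [ry|] := pselect (root (G k%:R) y); last by exists (fun=> 0).
  have [||f fk sf] := @section_itv k%:R k.+1%:R y _ _ ry; last by exists f.
    by rewrite ler_nat.
  by move=> t /andP[kt _]; apply: hG; rewrite (le_trans _ kt).
pose fix F k : R -> C := if k is m.+1 then
  fun x => if x <= m%:R then F m x else E (m, F m m%:R) x else fun=> z.
have sF k : F k 0 = z /\ section_on `[0, k%:R]%classic (F k).
  elim: k => [|k [IH0 IHs]].
    split => //; split=> [t _|t /=]; first exact: tends_cst.
    by rewrite in_itv /= => /le_anti <-.
  split; first by rewrite /= ler0n.
  have rk : root (G k%:R) (F k k%:R) by apply: IHs.2; rewrite /= in_itv /= ler0n lexx.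
  have [e1 e2] := hE (k, F k k%:R) rk.
  by apply: section_glue => //; rewrite ?ler_nat.
have FS k m x : (k <= m)%N -> x <= k%:R -> F m x = F k x.
  elim: m => [|m IHm]; first by rewrite leqn0 => /eqP ->.
  rewrite leq_eqVlt => /orP[/eqP -> //|]; rewrite ltnS => km xk.
  by rewrite /= (le_trans xk) ?ler_nat // IHm.
pose f x := F (Num.truncn x).+1 x.
have fF k x : 0 <= x -> x <= k%:R -> f x = F k x.
  move=> x0 xk; have /andP[t1 t2] := truncn_itv x0.
  have [le|lt] := leqP k (Num.truncn x).+1; first by rewrite /f (FS _ _ _ le).
  by rewrite /f (FS _ _ _ (ltnW lt)) // ltW.
exists f; first by rewrite (fF 0%N).
split=> [x /= x0|x /= x0]; last first.
  have /andP[_ /ltW t2] := truncn_itv x0.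
  by rewrite (fF _ _ x0 t2); apply: (sF _).2.2; rewrite /= in_itv /= x0.
have /andP[_ t2] := truncn_itv x0; set k := _.+1 in t2.
have xin : `[0, k%:R]%classic x by rewrite /= in_itv /= x0 ltW.
move=> e e0; have := (sF k).2.1 x xin e e0; rewrite /within /=.
have lk : \forall y \near x, y < k%:R by apply: lt_nbhsl.
move=> h; apply: filterS (filterI lk h) => y [yk hy] /= y0.
by rewrite !(fF k) ?(ltW yk) ?(ltW t2) //; apply: hy; rewrite in_itv /= y0 ltW.
Qed.

End Family.

Lemma tends_comp (D E : Type) (F : set_system D) (H : set_system E)
    (u : D -> E) (f : E -> C) (l : C) :
  (forall P, H P -> F [set x | P (u x)]) -> tends H f l -> tends F (f \o u) l.
Proof. by move=> uFH fl e e0; apply: (uFH _ (fl e e0)). Qed.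

Lemma cvg_inv_affine (a b c x : R) : b + x != 0 ->
  a / (b + y) - c @[y --> x] --> a / (b + x) - c.
Proof.
move=> bx; apply: cvgB; last exact: cvg_cst.
apply: cvgM; first exact: cvg_cst.
apply: cvgV => //; apply: cvgD; [exact: cvg_cst|exact: cvg_id].
Qed.

Lemma Re_norm (z : C) : (complex.Re `|z|)%:C = `|z|.
Proof. by rewrite RRe_real // normr_real. Qed.

(* A root path starting close to a cluster point [tau0] of roots cannot leave the
   cluster, by the intermediate value theorem. *)
Lemma root_path (G : R -> {poly C}) (n : nat) (t0 : R) (B tau0 : C) :
  (forall t, G t \is monic) -> (forall t, size (G t) = n.+1) ->
  (forall t, coef_cts G t) -> 0 < t0 ->
  (forall t, 0 < t <= t0 -> simple_roots G t) -> 0 <= B ->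
  (forall t z, 0 < t <= t0 -> root (G t) z -> `|z| <= B) ->
  root (G 0) tau0 ->
  exists t1 tau, [/\ 0 < t1 <= t0, section_on G `]0, t1]%classic tau &
    tends (0^'+) tau tau0].
Proof.
move=> Gm Gs Gc t00 simp B0 Bz rt0.
have [rs [srs Grs]] := family_roots Gm Gs 0.
have inrs z : (z \in rs) = root (G 0) z by rewrite Grs root_prod_XsubC.
have [rho rho0 sep] := exists_separation rs.
have n1 := roots_near Gm Gs (Gc 0) B0 rho0.
have n2 := root_near Gm Gs (Gc 0) rt0 rho0.
have [d d0 hd] := (near_dist _ _).1 (filterI n1 n2).
pose t1 := Num.min t0 (d / 2).
have t10 : 0 < t1 by rewrite lt_min t00 divr_gt0.
have t1t0 : t1 <= t0 by rewrite ge_min lexx.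
have t1d (t : R) : 0 < t <= t1 -> `|t - 0| < d.
  move=> /andP[p q]; rewrite subr0 gtr0_norm // (le_lt_trans q) //.
  by rewrite gt_min ltr_pdivrMr // ltr_pMr // ltr1n orbT.
have in0 (t : R) : 0 < t <= t1 -> 0 < t <= t0.
  by move=> /andP[-> /le_trans]; apply.
have [|h1 [z1 rz1 lz1]] := hd t1; first by rewrite t1d ?t10 ?lexx.
pose u (x : R) : R := t1 / (1 + x).
have uin (x : R) : 0 <= x -> 0 < u x <= t1.
  move=> x0; have x1 : 0 < 1 + x by rewrite ltr_wpDr.
  by rewrite divr_gt0 //= ler_pdivrMr // ler_peMr ?lerDl // ltW.
pose G' (x : R) := G (u x).
have G'c (x : R) : 0 <= x -> \forall s \near x, coef_cts G' s.
  move=> x0; apply/near_dist; exists 1 => // s sx i.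
  have s1 : 1 + s != 0.
    apply: lt0r_neq0; move: sx; rewrite ltr_norml => /andP[sx _].
    by rewrite -subr_gt0 subr0; move: sx x0; lra.
  apply: (@tends_comp _ _ _ (nbhs (u s)) u (fun t => (G t)`_i)); last exact: Gc.
  have := @cvg_inv_affine t1 1 0 s s1.
  by under eq_fun do rewrite subr0; rewrite subr0; apply.
have [||f f0 [cf rf]] := @section_ray G' n (fun x => Gm _) (fun x => Gs _) z1.
- by move=> x x0; split; [apply: simp; apply/in0/uin|exact: G'c].
- by rewrite /G' /u addr0 divr1.
have cluster (x : R) : 0 <= x -> `|f x - tau0| < rho.
  move=> x0; rewrite real_ltNge ?normr_real ?gtr0_real //; apply/negP => hx.
  pose dd (y : R) : R := complex.Re `|f y - tau0|.
  have ddE y : (dd y)%:C = `|f y - tau0| := Re_norm _.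
  have rhoE : (complex.Re rho)%:C = rho by rewrite RRe_real // gtr0_real.
  have [|||y yin dy] := @IVT R dd 0 x (complex.Re rho).
  - exact: x0.
  - apply/subspace_continuousP => y; rewrite /= in_itv /= => /andP[y0 yx].
    apply/cvgrPdist_lt => e e0.
    have e0' : 0 < e%:C by rewrite (ltcR 0).
    have := cf y y0 _ e0'; rewrite /within /=; apply: filterS => s h.
    rewrite in_itv /= => /andP[s0 _]; have {}h := h s0.
    rewrite -ltcR; apply: le_lt_trans h.
    rewrite -(_ : `|(dd y)%:C - (dd s)%:C| = `|dd y - dd s|%:C); last first.
      by rewrite -rmorphB normc_def /= expr0n /= addr0 sqrtr_sqr.
    rewrite !ddE (le_trans (ler_dist_dist _ _)) // opprB addrA subrK distrC.
    by [].
  - rewrite ge_min le_max -!lecR !ddE rhoE f0 hx (ltW lz1) orbT //.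
  have y0 : 0 <= y by move: yin; rewrite in_itv => /andP[].
  have ry := rf y y0.
  have yB : `|f y| <= B by apply: (Bz (u y)) => //; apply/in0/uin.
  have [hr _] := hd (u y) (t1d _ (uin y y0)).
  have [z' rz' lz'] := hr _ yB ry.
  have dy' : `|f y - tau0| = rho by rewrite -ddE dy.
  (* A root of [G 0] less than [rho] from [f y] is less than 2 rho from [tau0], hence equals it,
     although [f y] is exactly [rho] away from [tau0]. *)
  suff e : z' = tau0 by move: lz'; rewrite e distrC dy' ltxx.
  apply: sep; rewrite ?inrs //.
  have -> : z' - tau0 = (z' - f y) + (f y - tau0) by ring.
  by rewrite (le_lt_trans (ler_normD _ _)) // dy' ltrD2r.
pose w (t : R) : R := t1 / (0 + t) - 1.
have win (t : R) : 0 < t <= t1 -> 0 <= w t.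
  by move=> /andP[p q]; rewrite /w add0r subr_ge0 ler_pdivlMr // mul1r.
have uw (t : R) : 0 < t <= t1 -> u (w t) = t.
  move=> /andP[p q]; rewrite /u /w add0r addrC subrK invf_div mulrC divfK //.
  exact: lt0r_neq0.
have sec : section_on G `]0, t1]%classic (f \o w).
  split=> t /=; rewrite in_itv /= => tin; last first.
    by rewrite -{1}(uw t tin); apply: rf; apply: win.
  have := cf (w t) (win t tin); apply: tends_comp => P; rewrite /within /= => hP.
  have t0' : 0 + t != 0 by rewrite add0r lt0r_neq0 //; case/andP: tin.
  have h : nbhs t [set s | 0 <= w s -> P (w s)].
    exact: (@cvg_inv_affine t1 0 1 t t0' _ hP).
  move: h; apply: filterS => s /= h.
  by rewrite in_itv /= => /win; apply: h.
exists t1, (f \o w); split => //; first by rewrite t10.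
move=> e e0; have [c [c0 ce cr]] := pos_min e0 rho0.
have := roots_near Gm Gs (Gc 0) B0 c0; move=> /near_dist[d' d'0 hd'].
rewrite /at_right /within /=; apply/near_dist; exists (Num.min t1 d').
  by rewrite lt_min t10.
move=> s; rewrite lt_min subr0 => /andP[st1 sd'] s0.
rewrite gtr0_norm // in st1; rewrite gtr0_norm // in sd'.
have sin : 0 < s <= t1 by rewrite s0 ltW.
have ins : s \in `]0, t1] by rewrite in_itv.
have rs' : root (G s) ((f \o w) s) := sec.2 s ins.
have sB : `|(f \o w) s| <= B by apply: (Bz s) => //; apply: in0.
have [|z' rz' lz'] := hd' s _ _ sB rs'; first by rewrite subr0 gtr0_norm.
have ct := cluster _ (win s sin).
suff e1 : z' = tau0 by rewrite -e1 distrC (lt_le_trans lz').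
apply: sep; rewrite ?inrs //.
have -> : z' - tau0 = (z' - f (w s)) + (f (w s) - tau0) by ring.
by rewrite (le_lt_trans (ler_normD _ _)) // ltrD // (lt_le_trans lz').
Qed.

End PathLifting.

(** * Curve selection *)

Section Derivatives.
Variable C : numClosedFieldType.

Lemma poly_fun_eq0 (p : {poly C}) : (forall x, p.[x] = 0) -> p = 0.
Proof.
move=> h; apply/eqP; apply: contrapT => /negP /poly_nonroot[x].
by rewrite h eqxx.
Qed.

Lemma pfun_poly (f : (nat -> C) -> C) : pfun 1 f ->
  exists p : {poly C}, forall x, f (fun=> x) = p.[x].
Proof.
elim=> [c|i _|? ? _ [p hp] _ [q hq]|? ? _ [p hp] _ [q hq]].
- by exists c%:P => x; rewrite hornerC.
- by exists 'X => x; rewrite hornerX.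
- by exists (p + q) => x; rewrite hornerD hp hq.
- by exists (p * q) => x; rewrite hornerM hp hq.
Qed.

(** Partial derivatives enter through a first-order expansion along every line. As the remainder is
    x^2 times a polynomial, linear terms can be compared algebraically. *)
Lemma pfun_derivatives n (f : (nat -> C) -> C) : pfun n f ->
  exists D : nat -> (nat -> C) -> C, (forall i, pfun n (D i)) /\
    forall e v : nat -> C, exists r : {poly C}, forall x,
      f (fun i => e i + x * v i) =
      f e + x * (\sum_(i < n) v i * D i e) + x ^+ 2 * r.[x].
Proof.
elim=> [c|j jn|a b _ [A [pA hA]] _ [B [pB hB]]|a b pa [A [pA hA]] pb [B [pB hB]]].
- exists (fun _ _ => 0); split=> [i|e v]; first exact: Pconst.
  exists 0 => x; rewrite big1 => [|i _]; last by rewrite mulr0.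
  by rewrite horner0 !mulr0 !addr0.
- exists (fun i _ => (i == j)%:R); split=> [i|e v]; first exact: Pconst.
  exists 0 => x; rewrite horner0 mulr0 addr0 (bigD1 (Ordinal jn)) //= eqxx mulr1.
  rewrite big1 ?addr0 // => i ij; rewrite (_ : (i == j :> nat) = false) ?mulr0 //.
  by apply/negbTE; apply: contraNneq ij => ij; apply/eqP/val_inj.
- exists (fun i e => A i e + B i e); split=> [i|e v]; first exact: Padd.
  have [p hp] := hA e v; have [q hq] := hB e v; exists (p + q) => x.
  have -> : \sum_(i < n) v i * (A i e + B i e) =
      \sum_(i < n) v i * A i e + \sum_(i < n) v i * B i e.
    by rewrite -big_split; apply: eq_bigr => i _; rewrite mulrDr.
  by rewrite hp hq hornerD; ring.
exists (fun i e => A i e * b e + a e * B i e); split=> [i|e v].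
  by apply: Padd; apply: Pmul.
have [p hp] := hA e v; have [q hq] := hB e v.
set SA := \sum_(i < n) v i * A i e in hp; set SB := \sum_(i < n) v i * B i e in hq.
exists ((SA * SB)%:P + (a e)%:P * q + (b e)%:P * p +
        'X * (SA%:P * q + SB%:P * p) + 'X ^+ 2 * (p * q)) => x.
have -> : \sum_(i < n) v i * (A i e * b e + a e * B i e) = SA * b e + a e * SB.
  rewrite mulr_suml mulr_sumr -big_split; apply: eq_bigr => i _ /=; ring.
rewrite hp hq !(hornerD, hornerM, hornerC, hornerX, hornerXn); ring.
Qed.

End Derivatives.

Section CurveSelection.
Variables (R : realType).
Local Notation C := R[i].

Lemma tends_bounded_mul (D : Type) (F : set_system D) (f g : D -> C) (B : C) :
  Filter F -> 0 <= B -> F [set x | `|g x| <= B] -> tends F f 0 ->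
  tends F (fun x => f x * g x) 0.
Proof.
move=> FF B0 gB f0 e e0; have B1 : 0 < B + 1 by rewrite ltr_wpDl.
have e1 : 0 < e / (B + 1) by rewrite divr_gt0.
apply: filterS (filterI gB (f0 _ e1)) => x /= [h1 h2].
rewrite subr0 in h2; rewrite subr0 normrM.
apply: (@le_lt_trans _ _ (e / (B + 1) * B)); first by rewrite ler_pM // ltW.
by rewrite mulrAC ltr_pdivrMr // ltr_pM2l // ltrDl.
Qed.

Lemma tends_real (t : R) : tends (nbhs t) (fun s : R => s%:C) t%:C.
Proof.
move=> e e0; have eE : (complex.Re e)%:C = e by rewrite RRe_real // gtr0_real.
have re0 : 0 < complex.Re e by rewrite -ltcR eE.
apply/near_dist; exists (complex.Re e) => // s st /=.
rewrite -eE -rmorphB normc_def /= expr0n /= addr0 sqrtr_sqr.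
by rewrite ltcR.
Qed.

Lemma poly_nonroot_right (p : {poly C}) : p != 0 ->
  exists2 t0 : R, 0 < t0 & forall t, 0 < t <= t0 -> p.[t%:C] != 0.
Proof.
move=> p0; have [rs e] := closed_field_poly_normal p.
have [|d d0 hd] := @exists_le_norms R [seq z <- rs | z != 0].
  by apply/allP => z; rewrite mem_filter => /andP[].
have dE : (complex.Re d)%:C = d by rewrite RRe_real // gtr0_real.
exists (complex.Re d / 2); first by rewrite divr_gt0 // -ltcR dE.
move=> t /andP[t0 td]; apply/negP => /eqP pt.
have tp : 0 < t%:C by rewrite (ltcR 0).
have : d <= `|t%:C|.
  apply: hd; rewrite mem_filter lt0r_neq0 //=.
  have : root p t%:C by apply/rootP.
  by rewrite e rootZ ?lead_coef_eq0 // root_prod_XsubC.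
rewrite gtr0_norm // -dE lecR leNgt => /negP; apply.
rewrite (le_lt_trans td) // ltr_pdivrMr // ltr_pMr ?ltr1n // -ltcR dE.
by [].
Qed.

Variables (N M : nat) (phi : nat -> (nat -> C) -> C).
Hypothesis phi_pfun : forall j, (j < M)%N -> pfun N (phi j).
Hypothesis phi_cone : forall e c, exists e', forall j, (j < M)%N ->
  phi j e' = c * phi j e.

Let lin (a : nat -> nat -> C) i (y : nat -> C) := \sum_(l < M) a i l * y l.

Let proj a i e := lin a i (phi^~ e).

(** Quantitative transversality: the cone meets the kernel of the projection only at 0,
    uniformly. *)
Let good m a := exists2 K : C, 0 <= K & forall e j, (j < M)%N ->
  `|phi j e| <= K * \sum_(i < m) `|proj a i e|.

Let proj_scale a e e' c : (forall j, (j < M)%N -> phi j e' = c * phi j e) ->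
  forall i, proj a i e' = c * proj a i e.
Proof.
move=> h i; rewrite /proj /lin mulr_sumr; apply: eq_bigr => l _.
by rewrite h // mulrCA.
Qed.

(* If the projection of the cone avoids a neighbourhood of [u], projecting
   further along [u] keeps the cone transverse to the kernel. *)
Let noether_projection : exists m a, good m a /\
  forall (u : nat -> C) d, 0 < d ->
    exists e, forall i, (i < m)%N -> `|proj a i e - u i| < d.
Proof.
pose P m := `[< exists a, good m a >].
have exP : exists m, P m.
  exists M; apply/asboolP; exists (fun i l => (i == l)%:R), 1 => // e j jM.
  rewrite mul1r (bigD1 (Ordinal jM)) //= {1}/proj /lin (bigD1 (Ordinal jM)) //=.
  rewrite eqxx mul1r big1 => [|l lj].
    by rewrite addr0 lerDl sumr_ge0.
  rewrite (_ : (j == l :> nat) = false) ?mul0r //.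
  by apply/negbTE; apply: contraNneq lj => jl; apply/eqP/val_inj.
case: (ex_minnP exP) => m /asboolP[a [K K0 hK]] minm.
exists m, a; split; first by exists K.
move=> u d d0; apply: contrapT => nu.
have far e : exists2 j, (j < m)%N & d <= `|proj a j e - u j|.
  apply: contrapT => h; apply: nu; exists e => i im.
  rewrite real_ltNge ?normr_real ?gtr0_real //; apply/negP => le.
  by apply: h; exists i.
(* The cone contains 0, so a point that the projection stays away from is nonzero. *)
have [i0 i0m ui0] : exists2 i, (i < m)%N & u i != 0.
  apply: contrapT => h; have [e he] := phi_cone (fun=> 0) 0.
  have [j jm] := far e; rewrite (proj_scale a he) mul0r sub0r normrN.
  have -> : u j = 0 by apply: contrapT => /eqP uj; apply: h; exists j.
  by rewrite normr0 => /(lt_le_trans d0); rewrite ltxx.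
(* The old projection modulo the line through [u]; [bump] skips the coordinate [i0] that becomes
   zero. *)
pose a' i l := a (bump i0 i) l - u (bump i0 i) / u i0 * a i0 l.
have pa' i e : proj a' i e = proj a (bump i0 i) e - u (bump i0 i) / u i0 * proj a i0 e.
  rewrite /proj /lin mulr_sumr -sumrB; apply: eq_bigr => l _.
  by rewrite /a' mulrBl mulrA.
have [m' em] : exists m', m = m'.+1 by exists m.-1; rewrite prednK // (leq_ltn_trans _ i0m).
suff : P m' by move/minm; rewrite em ltnn.
apply/asboolP; exists a'.
exists (K * \sum_(j < m) (1 + `|u j| / d)).
  by rewrite mulr_ge0 // sumr_ge0 // => j _; rewrite addr_ge0 // divr_ge0 // ltW.
move=> e j jM; apply: (le_trans (hK e j jM)); rewrite -mulrA ler_wpM2l //.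
set S' := \sum_(i < m') _; have S0 : 0 <= S' by apply: sumr_ge0.
pose c := proj a i0 e / u i0.
have near l : (l < m)%N -> `|proj a l e - c * u l| <= S'.
  move=> lm; have [->|li] := eqVneq l i0.
    by rewrite /c divfK // subrr normr0.
  have lm' : (unbump i0 l < m')%N.
    rewrite /unbump; move: lm li i0m; rewrite em !ltnS.
    by case: (ltngtP i0 l) => //=; rewrite ?subn1 ?subn0; lia.
  have lb : bump i0 (unbump i0 l) = l by rewrite unbumpK // inE.
  rewrite /S' (bigD1 (Ordinal lm')) //= pa' lb.
  by rewrite {1}/c mulrAC -mulrA mulrC -mulrA (mulrC (u i0)^-1) lerDl sumr_ge0.
(* Scaling the cone point by the inverse of [c] gives one whose projection is at least [d] from [u],
   which bounds |c| d by the new projection. This is the origin of the factors 1 + |u_j| / d. *)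
have cS : `|c| <= S' / d.
  have [c0|c0] := eqVneq c 0; first by rewrite c0 normr0 divr_ge0 // ltW.
  have [e' he'] := phi_cone e c^-1; have [l lm] := far e'.
  rewrite (proj_scale a he') => hl; rewrite ler_pdivlMr //.
  apply: le_trans (near l lm).
  have -> : proj a l e - c * u l = c * (c^-1 * proj a l e - u l).
    by rewrite mulrBr mulVKf.
  by rewrite (normrM c) ler_wpM2l.
rewrite mulr_suml; apply: ler_sum => l _.
rewrite -[proj a l e](subrK (c * u l)) (le_trans (ler_normD _ _)) //.
rewrite mulrDl mul1r lerD ?near // (normrM c) mulrC -mulrA ler_wpM2l //.
by rewrite mulrC.
Qed.

(** * The incidence set of a projection of minimal dimension *)

Section Incidence.
Variables (m : nat) (a : nat -> nat -> C) (K : C).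
Hypothesis K_ge0 : 0 <= K.
Hypothesis phi_bound : forall e j, (j < M)%N ->
  `|phi j e| <= K * \sum_(i < m) `|proj a i e|.
Hypothesis proj_dense : forall (u : nat -> C) d, 0 < d ->
  exists e, forall i, (i < m)%N -> `|proj a i e - u i| < d.

Let k := (M + m)%N.

Let par (x : nat -> C) : nat -> C := fun j => x (M + j)%N.

(* The incidence set of all (s, p(y), s.y), with y in the cone and s a linear
   form. *)
Let psi (i : nat) (x : nat -> C) : C :=
  if (i < M)%N then x i else
  if (i < k)%N then proj a (i - M) (par x) else \sum_(j < M) x j * phi j (par x).

Let psi_lin x : psi k x = \sum_(j < M) x j * phi j (par x).
Proof. by rewrite /psi ltnNge leq_addr ltnn. Qed.

Let psi_proj x i : (i < m)%N -> psi (M + i) x = proj a i (par x).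
Proof. by move=> im; rewrite /psi ltnNge leq_addr /= ltn_add2l im addKn. Qed.

Let psi_pfun i : (i < k.+1)%N -> pfun (M + N) (psi i).
Proof.
have pphi j : (j < M)%N -> pfun (M + N) (fun x => phi j (par x)).
  move=> jM; apply: (pfun_comp (phi_pfun jM)) => l lN.
  by apply: Pvar; rewrite ltn_add2l.
rewrite ltnS leq_eqVlt => /orP[/eqP -> | ik].
  apply: pfun_eq (fun x => esym (psi_lin x)).
  apply: pfun_sum => j _; apply: Pmul; last exact: pphi.
  by apply: Pvar; apply: leq_trans (leq_addr _ _).
have [iM|Mi] := ltnP i M.
  apply: (pfun_eq (Pvar C (leq_trans iM (leq_addr N M)))) => x.
  by rewrite /psi iM.
have pp : pfun (M + N) (fun x => proj a (i - M) (par x)).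
  apply: pfun_sum => j _; apply: Pmul; first exact: Pconst.
  exact: pphi.
by apply: (pfun_eq pp) => x; rewrite /psi ltnNge Mi ik.
Qed.

Let psi_sum x : \sum_(i < k) `|psi i x| =
  \sum_(i < M) `|x i| + \sum_(i < m) `|proj a i (par x)|.
Proof.
rewrite big_split_ord /=; congr (_ + _); apply: eq_bigr => i _.
  by rewrite /psi ltn_ord.
by rewrite psi_proj.
Qed.

Let psi_bound x : `|psi k x| <= K * (1 + \sum_(i < k) `|psi i x|) ^+ 2.
Proof.
rewrite psi_lin psi_sum; set S := \sum_(i < M) `|x i|.
set T := \sum_(i < m) _; have S0 : 0 <= S by apply: sumr_ge0.
have T0 : 0 <= T by apply: sumr_ge0.
apply: (@le_trans _ _ (K * (S * T))).
  rewrite mulrCA mulr_suml (le_trans (ler_norm_sum _ _ _)) // ler_sum // => j _.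
  by rewrite normrM ler_wpM2l // phi_bound.
rewrite ler_wpM2l // expr2 ler_pM //.
  by rewrite addrCA lerDl addr_ge0.
by rewrite addrA lerDr addr_ge0.
Qed.

Let base (s u : nat -> C) : nat -> C := fun i => if (i < M)%N then s i else u (i - M)%N.

(** The linear form is free and the projection is dense in the Euclidean sense; continuity turns
    this into Zariski density. *)
Let psi_dense (h : mp C k) : (forall x, ev k (psi^~ x) h = 0) -> h = 0.
Proof.
move=> hh; apply: ev_eq0 => b.
pose F : set_system (nat -> C) := fun A =>
  exists2 d : C, 0 < d & forall x, (forall i, (i < k)%N -> `|psi i x - b i| < d) -> A x.
have FF : ProperFilter F.
  split.
    move=> [d d0 h0].
    have [e he] := @proj_dense (fun i => b (M + i)%N) d d0.
    apply: (h0 (fun i => if (i < M)%N then b i else e (i - M)%N)) => i ik.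
    have [iM|Mi] := ltnP i M; first by rewrite /psi iM subrr normr0.
    rewrite -(subnKC Mi) psi_proj; last by rewrite -(ltn_add2l M) subnKC.
    rewrite (_ : par _ = e).
      by apply: he; rewrite -(ltn_add2l M) subnKC.
    by apply: funext => j; rewrite /par ltnNge leq_addr /= addKn.
  split.
  - by exists 1.
  - move=> P Q [d1 d10 h1] [d2 d20 h2].
    have [c [c0 c1 c2]] := pos_min d10 d20.
    exists c => // x hx; split; [apply: h1|apply: h2] => i ik.
      exact: lt_le_trans (hx i ik) c1.
    exact: lt_le_trans (hx i ik) c2.
  - by move=> P Q PQ [d d0 h0]; exists d => // x /h0 /PQ.
have tF : tends F (fun x => ev k (psi^~ x) h) (ev k b h).
  apply: (tends_pfun (g := fun x i => psi i x) FF (pfun_ev h)) => i ik e e0.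
  by exists e => // x; apply.
apply: (tends_dominated FF (lexx 0) tF (tends_cst FF 0)).
apply: filterS filterT => x _ /=.
by rewrite hh normr0 mul0r.
Qed.

(** * Recovering points from a root of the fibre equation *)

Section FibrePolynomial.
Variables (F : {poly mp C k}) (h : mp C k).
Hypothesis F_monic : F \is monic.
Hypothesis h_neq0 : h != 0.
Hypothesis F_vanish : forall x, ev k.+1 (psi^~ x) F = 0.
Hypothesis F_root : forall b t, ev k b h != 0 -> root (map_poly (ev k b) F) t ->
  (exists x, (forall i, (i < k)%N -> psi i x = b i) /\ psi k x = t) /\
  (map_poly (ev k b) F^`()).[t] != 0.

Let fiber b := map_poly (ev k b) F.

Let n := (size F).-1.

Let fiber_monic b : fiber b \is monic.
Proof. by apply: monic_map. Qed.

Let fiber_size b : size (fiber b) = n.+1.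
Proof.
rewrite /fiber size_map_poly_id0; last first.
  by rewrite (monicP F_monic) rmorph1 oner_eq0.
by rewrite /n prednK // size_poly_gt0 monic_neq0.
Qed.

Let fiber_ext b b' : (forall i, (i < k)%N -> b i = b' i) -> fiber b = fiber b'.
Proof. by move=> e; apply: eq_map_poly => c; apply: ev_ext. Qed.

(** For fixed [s] this is a polynomial in [y] that vanishes on the cone, so it vanishes at [w] too:
    this is how the hypothesis on [w] is used. *)
Let equ (s y : nat -> C) : C :=
  (fiber (base s (fun i => lin a i y))).[\sum_(j < M) s j * y j].

Let equ_cone s e : equ s (phi^~ e) = 0.
Proof.
pose x i := if (i < M)%N then s i else e (i - M)%N.
have px : par x = e.
  by apply: funext => j; rewrite /par /x ltnNge leq_addr /= addKn.
apply: etrans (F_vanish x); rewrite /equ evS psi_lin px; congr (_.[_]).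
  apply: fiber_ext => i ik; rewrite /base; case: ltnP => iM.
    by rewrite /psi /x !iM.
  by rewrite /psi ltnNge iM ik /= px.
by apply: eq_bigr => j _; rewrite /x ltn_ord.
Qed.

Let equ_pfun s : pfun M (equ s).
Proof.
have p : pfun M (fun y => ev k.+1
    (fun i => if (i == k)%N then \sum_(j < M) s j * y j
              else base s (fun i => lin a i y) i) F).
  apply: (pfun_comp (pfun_ev (F : mp C k.+1))
    (g := fun i y => if (i == k)%N then \sum_(j < M) s j * y j
              else base s (fun i => lin a i y) i)) => i _.
  case: eqP => _.
    by apply: pfun_sum => j _; apply: Pmul; [exact: Pconst|apply: Pvar].
  rewrite /base; case: (i < M)%N; first exact: Pconst.
  by apply: pfun_sum => j _; apply: Pmul; [exact: Pconst|apply: Pvar].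
apply: (pfun_eq p) => y; rewrite evS eqxx; congr (_.[_]).
by apply: fiber_ext => i ik; rewrite (ltn_eqF ik).
Qed.

(* Differentiating the fibre equation in s_j recovers the coordinate y_j. *)
Let coordinate_formula : exists D : nat -> (nat -> C) -> C,
  (forall i, pfun k.+1 (D i)) /\ forall x,
    (map_poly (ev k (psi^~ x)) F^`()).[psi k x] != 0 ->
    D k (psi^~ x) != 0 /\
    forall j, (j < M)%N -> phi j (par x) = - D j (psi^~ x) / D k (psi^~ x).
Proof.
have [D [pD hD]] := pfun_derivatives (pfun_ev (F : mp C k.+1)).
exists D; split => // x hx.
have cancel_lin (c : C) (r : {poly C}) :
    (forall z, 0 = 0 + z * c + z ^+ 2 * r.[z]) -> c = 0.
  move=> hz; have : 'X * (c%:P + 'X * r) = 0.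
    apply: poly_fun_eq0 => z; rewrite !(hornerM, hornerD, hornerX, hornerC).
    by rewrite [RHS](hz z); ring.
  move=> /eqP; rewrite mulf_eq0 polyX_eq0 /= => /eqP e.
  have := congr1 (fun p => p.[0]) e.
  by rewrite !(hornerM, hornerD, hornerX, hornerC) mul0r addr0.
(* Both sides are the linear coefficient of the fibre polynomial at its root; the right one is read
   off from a factorization Q (X - psi k x). *)
have DkE : D k (psi^~ x) = (map_poly (ev k (psi^~ x)) F^`()).[psi k x].
  have [r hr] := hD (psi^~ x) (fun i => (i == k)%:R).
  have /factor_theorem[Q fQ] : root (fiber (psi^~ x)) (psi k x).
    by rewrite rootE -evS F_vanish.
  have dQ : (map_poly (ev k (psi^~ x)) F^`()).[psi k x] = Q.[psi k x].
    rewrite -deriv_map -/(fiber _) fQ derivM derivXsubC mulr1 hornerD hornerM.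
    by rewrite hornerXsubC subrr mulr0 add0r.
  rewrite dQ; apply/eqP; rewrite -subr_eq0; apply/eqP.
  pose Q0 := Q \Po ('X + (psi k x)%:P) - Q.[psi k x]%:P.
  have Q0E z : Q0.[z] = Q.[z + psi k x] - Q.[psi k x].
    by rewrite /Q0 hornerD hornerN horner_comp hornerD hornerX !hornerC.
  have /factor_theorem[Q1 qX] : root Q0 0 by rewrite rootE Q0E add0r subrr.
  pose r' := r - Q1.
  apply: (cancel_lin _ r') => z; have := hr z.
  rewrite F_vanish evS eqxx mulr1.
  have -> : map_poly (ev k (fun i => psi i x + z * (i == k)%:R)) F = fiber (psi^~ x).
    by apply: fiber_ext => i ik; rewrite (ltn_eqF ik) mulr0 addr0.
  have -> : \sum_(i < k.+1) (i == k :> nat)%:R * D i (psi^~ x) = D k (psi^~ x).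
    rewrite big_ord_recr /= eqxx mul1r big1 ?add0r // => i _.
    by rewrite (ltn_eqF (ltn_ord i)) mul0r.
  rewrite fQ hornerM hornerXsubC (addrC (psi k x)) addrK => e.
  have := congr1 (fun p => p.[z]) qX.
  rewrite Q0E hornerM hornerXsubC subr0 => eQ.
  rewrite /r' hornerD hornerN.
  have -> : 0 + z * (D k (psi^~ x) - Q.[psi k x]) + z ^+ 2 * (r.[z] - Q1.[z]) =
     (0 + z * D k (psi^~ x) + z ^+ 2 * r.[z]) - z * (Q1.[z] * z + Q.[psi k x]) by ring.
  by rewrite -e -eQ subrK; ring.
split=> [|j jM]; first by rewrite DkE.
(* Moving s_j by z moves s.y by z y_j and fixes p(y), so the point stays in the incidence set. The
   expansion of [F] along this direction is thus 0, and so is its linear term D_j + y_j D_k. *)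
have [r hr] := hD (psi^~ x)
  (fun i => if i == k then phi j (par x) else (i == j)%:R).
have k1 : D k (psi^~ x) != 0 by rewrite DkE.
apply: (mulIf k1); rewrite divfK //; apply/eqP; rewrite -subr_eq0 opprK; apply/eqP.
apply: (cancel_lin _ r) => z; have := hr z; rewrite F_vanish.
have -> : \sum_(i < k.+1) (if i == k :> nat then phi j (par x) else (i == j :> nat)%:R) *
    D i (psi^~ x) = phi j (par x) * D k (psi^~ x) + D j (psi^~ x).
  rewrite big_ord_recr /= eqxx addrC; congr (_ + _).
  have jk : (j < k)%N by apply: leq_trans jM (leq_addr _ _).
  rewrite (bigD1 (Ordinal jk)) //= eqxx (ltn_eqF jk) mul1r big1 ?addr0 // => i ij.
  rewrite (ltn_eqF (ltn_ord i)) (_ : (i == j :> nat) = false) ?mul0r //.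
  by apply/negbTE; apply: contraNneq ij => ij; apply/eqP/val_inj.
move=> <-; pose x' i := if i == j then x i + z else x i.
have px : par x' = par x.
  apply: funext => i; rewrite /par /x' (_ : (M + i == j)%N = false) //.
  by apply/gtn_eqF/(leq_trans jM)/leq_addr.
rewrite -[LHS](F_vanish x'); apply: ev_ext => i.
rewrite ltnS leq_eqVlt => /orP[/eqP -> | ik].
  rewrite eqxx !psi_lin px (bigD1 (Ordinal jM)) //= [in RHS](bigD1 (Ordinal jM)) //=.
  rewrite /x' eqxx mulrDl addrAC; congr (_ + _ + _).
  apply: eq_bigr => l lj; rewrite (_ : (l == j :> nat) = false) //.
  by apply/negbTE; apply: contraNneq lj => lj; apply/eqP/val_inj.
rewrite (ltn_eqF ik) /psi px ik; case: ltnP => iM; last first.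
  by rewrite (gtn_eqF (leq_trans jM iM)) mulr0 addr0.
by rewrite /x'; case: eqP => _; rewrite ?mulr1 // mulr0 addr0.
Qed.

(** For this form the fibre polynomial over p(y) has the coordinate y_j among its roots. *)
Let unit_form (j : nat) : nat -> C := fun i => (i == j)%:R.

Let unit_form_sum j (y : nat -> C) : (j < M)%N ->
  \sum_(l < M) unit_form j l * y l = y j.
Proof.
move=> jM; rewrite (bigD1 (Ordinal jM)) //= /unit_form eqxx mul1r big1 ?addr0 //.
move=> l lj; rewrite (_ : (l == j :> nat) = false) ?mul0r //.
by apply/negbTE; apply: contraNneq lj => lj; apply/eqP/val_inj.
Qed.

(* [r j] is meant to list the roots of the fibre polynomial of the j-th coordinate,
   so that the points y range over a finite grid. *)
Let separating_form (w : nat -> C) (r : nat -> seq C) :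
  (forall j, size (r j) = n) ->
  exists s : nat -> C, exists2 eta : C, 0 < eta &
    forall y : nat -> C, (forall j, (j < M)%N -> y j \in r j) ->
      `|\sum_(j < M) s j * y j - \sum_(j < M) s j * w j| < eta ->
      forall j, (j < M)%N -> y j = w j.
Proof.
(* The form is sought as s_j = x^j. Each grid point then gives a polynomial in x, nonzero unless the
   point is [w]; [x] avoids the finitely many roots and [eta] is a lower bound for the nonzero
   values. *)
move=> sr; pose pol (f : {ffun 'I_M -> 'I_n}) : {poly C} :=
  \sum_(j < M) ((r j)`_(f j) - w j) *: 'X^j.
pose P := \prod_(f : {ffun 'I_M -> 'I_n} | pol f != 0) pol f.
have /poly_nonroot[x hx] : P != 0.
  by rewrite prodf_seq_neq0; apply/allP => f _; apply/implyP.
have nz f : pol f != 0 -> (pol f).[x] != 0.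
  move=> f0; apply: contraNneq hx => z.
  by rewrite /P (bigD1 f) //= hornerM z mul0r.
have [|eta eta0 heta] := @exists_le_norms R
    [seq (pol f).[x] | f <- enum {ffun 'I_M -> 'I_n} & pol f != 0].
  by apply/allP => z /mapP[f]; rewrite mem_filter => /andP[/nz f0 _] ->.
exists (fun j => x ^+ j); exists eta => // y yr lt j jM.
have idx (i : 'I_M) : exists c : 'I_n, (r i)`_c = y i.
  have yi := yr i (ltn_ord i).
  have lti : (index (y i) (r i) < n)%N by rewrite -(sr i) index_mem.
  by exists (Ordinal lti); rewrite /= nth_index.
have /choice[c hc] := idx; pose f := [ffun i => c i].
have polE : (pol f).[x] = \sum_(j < M) x ^+ j * y j - \sum_(j < M) x ^+ j * w j.
  rewrite /pol horner_sum -sumrB; apply: eq_bigr => i _.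
  by rewrite hornerZ hornerXn ffunE hc mulrBl !(mulrC (x ^+ i)).
have [f0|f0] := eqVneq (pol f) 0.
  have := congr1 (fun p : {poly C} => p`_j) f0.
  rewrite coef0 /pol coef_sum (bigD1 (Ordinal jM)) //= big1 => [|i ij].
    have hcj : (r j)`_(c (Ordinal jM)) = y j := hc (Ordinal jM).
    by rewrite coefZ coefXn eqxx mulr1 addr0 ffunE hcj => /eqP; rewrite subr_eq0 => /eqP.
  rewrite coefZ coefXn (_ : (j == i :> nat) = false) ?mulr0 //.
  by apply/negbTE; apply: contraNneq ij => ij; apply/eqP/val_inj.
have : eta <= `|(pol f).[x]|.
  by apply: heta; apply/mapP; exists f => //; rewrite mem_filter f0 mem_enum.
by rewrite polE => /le_lt_trans/(_ lt); rewrite ltxx.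
Qed.

Let seg (b0 b1 : nat -> C) (t : R) : nat -> C :=
  fun i => b0 i + t%:C * (b1 i - b0 i).

Let seg_cts b0 b1 i t : tends (nbhs t) (fun s => seg b0 b1 s i) (seg b0 b1 t i).
Proof.
apply: tendsD; first exact: tends_cst.
by apply: tendsM; [exact: tends_real|exact: tends_cst].
Qed.

Let seg_bound b0 b1 (t0 t : R) i : 0 < t <= t0 ->
  `|seg b0 b1 t i| <= `|b0 i| + t0%:C * `|b1 i - b0 i|.
Proof.
move=> /andP[p q]; rewrite (le_trans (ler_normD _ _)) // lerD2l normrM.
have t0C : 0 <= t%:C by rewrite (lecR 0) ltW.
by rewrite ler_wpM2r // ger0_norm // lecR.
Qed.

Let fiber_coef_cts (c : R -> nat -> C) t :
  (forall i, (i < k)%N -> tends (nbhs t) (fun s => c s i) (c t i)) ->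
  coef_cts (fun s => fiber (c s)) t.
Proof.
move=> hc i; rewrite /fiber coef_map.
apply: tends_near (tends_pfun _ (pfun_ev F`_i) hc).
by apply: filterS filterT => s _ /=; rewrite coef_map.
Qed.

(** Near the endpoint each coordinate of the lifted point is close to a root in the finite list
    [r j], and its value under [s0] is close to s0.w. Since [s0] separates [w] from the other grid
    points, the nearby grid point is [w]. *)
Let limit_curve w : (forall s, equ s w = 0) ->
  exists (t1 : R) (q : R -> nat -> C), [/\ 0 < t1,
    forall t, 0 < t <= t1 -> exists e, forall j, (j < M)%N -> q t j = phi j e,
    forall j, (j < M)%N -> cts_on `]0, t1]%classic (q^~ j) &
    forall j, (j < M)%N -> tends (0^'+) (q^~ j) (w j)].
Proof.
move=> hw; pose u0 i := lin a i w.
have /choice[r hr] : forall j, exists rs : seq C, size rs = n /\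
    fiber (base (unit_form j) u0) = \prod_(z <- rs) ('X - z%:P).
  move=> j; have [rs e] := closed_field_poly_normal (fiber (base (unit_form j) u0)).
  rewrite (monicP (fiber_monic _)) scale1r in e; exists rs; split => //.
  by have := fiber_size (base (unit_form j) u0); rewrite e size_prod_XsubC => -[].
have [s0 [eta eta0 sep]] := separating_form w (fun j => (hr j).1).
pose b0 := base s0 u0.
have [b1 hb1] := ev_neq0 h_neq0.
pose be := seg b0 b1.
have [p hp] : exists p : {poly C}, forall z,
    ev k (fun i => b0 i + z * (b1 i - b0 i)) h = p.[z].
  apply: (@pfun_poly _ (fun e => ev k (fun i => b0 i + e 0%N * (b1 i - b0 i)) h)).
  apply: (pfun_comp (pfun_ev h) (g := fun i e => b0 i + e 0%N * (b1 i - b0 i))) => i _.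
  by apply: Padd; [|apply: Pmul]; [exact: Pconst|exact: Pvar|exact: Pconst].
have p0 : p != 0.
  apply: contraNneq hb1 => z; have := hp 1; rewrite z horner0 => <-.
  by apply/eqP/ev_ext => i _; rewrite mul1r addrC subrK.
have [t0 t00 ht0] := poly_nonroot_right p0.
have hbe t : 0 < t <= t0 -> ev k (be t) h != 0 by move=> /ht0; rewrite -hp.
have be0 i : be 0 i = b0 i by rewrite /be /seg mul0r addr0.
pose Bs := \sum_(i < k) (`|b0 i| + t0%:C * `|b1 i - b0 i|).
have t0C : 0 <= t0%:C by rewrite (lecR 0) ltW.
have Bs0 : 0 <= Bs by apply: sumr_ge0 => i _; rewrite addr_ge0 // mulr_ge0.
have beB t : 0 < t <= t0 -> \sum_(i < k) `|be t i| <= Bs.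
  by move=> ht; apply: ler_sum => i _; apply: seg_bound.
pose tau0 := \sum_(j < M) s0 j * w j.
have [||||||||t1 [tau [/andP[t10 t1t0] [tc tr] tl]]] :=
    @root_path R (fun t => fiber (be t)) n t0 (K * (1 + Bs) ^+ 2) tau0.
- by move=> t; apply: fiber_monic.
- by move=> t; apply: fiber_size.
- by move=> t; apply: fiber_coef_cts => i _; apply: seg_cts.
- exact: t00.
- by move=> t ht z rz; rewrite /fiber deriv_map; apply: (F_root (hbe t ht) rz).2.
- by rewrite mulr_ge0 // exprn_ge0 // addr_ge0.
- move=> t z ht rz; have [[x [xb <-]] _] := F_root (hbe t ht) rz.
  rewrite (le_trans (psi_bound x)) // ler_wpM2l // lerXn2r // ?nnegrE.
  + by rewrite addr_ge0 // sumr_ge0.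
  + by rewrite addr_ge0.
  + rewrite lerD2l (le_trans _ (beB t ht)) //.
    by apply: ler_sum => i _; rewrite xb.
- rewrite rootE; have := hw s0; rewrite /equ => /eqP; apply: etrans.
  by congr (_.[_] == _); apply: fiber_ext => i _; rewrite be0.
have in0 (t : R) : 0 < t <= t1 -> 0 < t <= t0.
  by move=> /andP[-> /le_trans]; apply.
(* These preimages are chosen with no continuity; [coordinate_formula] shows afterwards that [q]
   depends continuously on [t]. *)
have /choice[xx hxx] : forall t, exists x, 0 < t <= t1 ->
    [/\ forall i, (i < k)%N -> psi i x = be t i, psi k x = tau t &
        (map_poly (ev k (be t)) F^`()).[tau t] != 0].
  move=> t; have [ht|] := boolP (0 < t <= t1); last by exists (fun=> 0).
  have rt : root (fiber (be t)) (tau t) by apply: tr; rewrite /= in_itv.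
  by have [[x [xb xt]] dt] := F_root (hbe t (in0 t ht)) rt; exists x.
pose q t j := phi j (par (xx t)).
have [D [pD hD]] := coordinate_formula.
pose et t i := if i == k then tau t else be t i.
have etE t i : 0 < t <= t1 -> (i < k.+1)%N -> psi i (xx t) = et t i.
  move=> ht; have [xb xt _] := hxx t ht; rewrite ltnS leq_eqVlt /et.
  by case: eqP => [-> _|_ /= ik] //; apply: xb.
have qD t j : 0 < t <= t1 -> (j < M)%N ->
    D k (et t) != 0 /\ q t j = - D j (et t) / D k (et t).
  move=> ht jM; have [xb xt dt] := hxx t ht.
  have [|Dk qj] := hD (xx t).
    rewrite xt; rewrite (_ : map_poly _ _ = map_poly (ev k (be t)) F^`()) //.
    by apply: eq_map_poly => c; apply: ev_ext.
  have DE i : D i (psi^~ (xx t)) = D i (et t).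
    by apply: (pfun_ext (pD i)) => l lk; apply: etE.
  by rewrite -!DE; split => //; apply: qj.
have qB t j : 0 < t <= t1 -> (j < M)%N -> `|q t j| <= K * Bs.
  move=> ht jM; rewrite (le_trans (phi_bound _ jM)) // ler_wpM2l //.
  rewrite (le_trans _ (beB t (in0 t ht))) // big_split_ord /=.
  have [xb _ _] := hxx t ht; rewrite ler_wpDl ?sumr_ge0 //.
  by apply: ler_sum => i _; rewrite -psi_proj // xb // ltn_add2l.
have FR : ProperFilter (0^'+ : set_system R) by apply: at_right_proper_filter.
have near_t1 : 0^'+ [set t : R | 0 < t <= t1].
  rewrite /at_right /within /=; apply/near_dist; exists t1 => // s.
  by rewrite subr0 => st s0'; rewrite s0' -(gtr0_norm s0') ltW.
have right_nbhs (f : R -> C) l : tends (nbhs (0 : R)) f l -> tends (0^'+) f l.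
  by move=> fl e e0; rewrite /at_right /within /=; apply: filterS (fl e e0).
exists t1, q; split => //.
- by move=> t _; exists (par (xx t)).
- move=> j jM t; rewrite /= in_itv /= => ht.
  have WF : Filter (within `]0, t1]%classic (nbhs t)) by apply: within_filter.
  have tet i : (i < k.+1)%N -> tends (within `]0, t1]%classic (nbhs t)) (fun s => et s i) (et t i).
    rewrite /et; case: eqP => [_ _|_ _]; first by apply: tc; rewrite /= in_itv.
    by move=> e e0; rewrite /within /=; apply: filterS (seg_cts b0 b1 i t e0).
  have [Dk ->] := qD t j ht jM.
  have := tendsM WF (tendsN WF (tends_pfun WF (pD j) tet))
    (tendsV WF Dk (tends_pfun WF (pD k) tet)).
  apply: tends_near; rewrite /within /=; apply: filterS filterT => s _.
  by rewrite in_itv /= => hs; rewrite (qD s j hs jM).2.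
move=> j jM e e0.
(* The root [tau t] evaluates [q t] by the moving form. The difference from [s0] tends to 0 and [q]
   is bounded, so the fixed form has the same limit. *)
pose A t := \sum_(j < M) s0 j * q t j.
have tA : tends (0^'+) A tau0.
  have : tends (0^'+) (fun t => tau t + \sum_(j < M) (s0 j - be t j) * q t j)
      (tau0 + \sum_(j < M) 0).
    apply: tendsD => //; apply: tends_sum => i.
    apply: (tends_bounded_mul (B := K * Bs)) => //.
    + by rewrite mulr_ge0.
    + by apply: filterS near_t1 => t /= ht; apply: qB.
    have -> : 0 = s0 i - be 0 i by rewrite be0 /b0 /base ltn_ord subrr.
    by apply: right_nbhs; apply: tendsB; [exact: tends_cst|exact: seg_cts].
  rewrite big1_eq addr0; apply: tends_near.
  apply: filterS near_t1 => t /= ht; have [xb <- _] := hxx t ht.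
  rewrite psi_lin -big_split; apply: eq_bigr => i _ /=.
  rewrite -xb; last by apply: leq_trans (leq_addr _ _).
  by rewrite /psi ltn_ord /q -mulrDl addrC subrK.
pose S := 1 + \sum_(j < M) `|s0 j|.
have S0 : 0 < S by rewrite ltr_wpDr // sumr_ge0.
(* Replacing [q t] by a grid point within [c] changes its value under [s0] by at most eta / 2; the
   other half of [eta] pays for [A t] against [tau0]. *)
have [c [c0 ce cS]] := pos_min e0 (divr_gt0 (divr_gt0 eta0 (ltr0Sn _ 1)) S0).
have nearA := tA _ (divr_gt0 eta0 (ltr0Sn _ 1)).
have nearR : 0^'+ [set t : R | forall l, l \in iota 0 M ->
    exists2 z, z \in r l & `|z - q t l| < c].
  apply: near_all_seq => l; rewrite mem_iota add0n => /= lM.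
  (* The form is frozen at the unit form while the projection moves; [q t l] is a root by
     [equ_cone]. *)
  pose Hl t := fiber (base (unit_form l) (fun i => be t (M + i)%N)).
  have Hc : coef_cts Hl 0.
    apply: fiber_coef_cts => i _; rewrite /base.
    case: (i < M)%N; [exact: tends_cst|exact: seg_cts].
  have KB : 0 <= K * Bs by rewrite mulr_ge0.
  have := @roots_near R Hl n (fun t => fiber_monic _) (fun t => fiber_size _) 0 _ c Hc KB c0.
  move=> hn; have {}hn : 0^'+ [set t : R | forall z, `|z| <= K * Bs ->
      root (Hl t) z -> exists2 z', root (Hl 0) z' & `|z' - z| < c].
    by rewrite /at_right /within /=; apply: filterS hn => s hs _.
  apply: filterS (filterI hn near_t1) => t /= [hz ht].
  have [|z rz lz] := hz (q t l) (qB t l ht lM).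
    have := equ_cone (unit_form l) (par (xx t)); rewrite /equ (unit_form_sum (phi^~ (par (xx t))) lM).
    rewrite rootE => /eqP; apply: etrans; congr (_.[_] == _).
    apply: fiber_ext => i ik; rewrite /base; case: ltnP => // iM.
    have [xb _ _] := hxx t ht; rewrite -xb ?subnKC //.
    by rewrite /psi ltnNge iM ik.
  exists z => //; move: rz; rewrite /Hl.
  rewrite (_ : fiber _ = fiber (base (unit_form l) u0)).
    by rewrite (hr l).2 root_prod_XsubC.
  apply: fiber_ext => i ik; rewrite /base; case: ltnP => // iM.
  by rewrite be0 /b0 /base ltnNge leq_addr /= addKn.
apply: filterS (filterI nearA nearR) => t /= [hA hR].
have /choice[y hy] : forall l, exists z, (l < M)%N -> z \in r l /\ `|z - q t l| < c.
  move=> l; have [lM|] := boolP (l < M)%N; last by exists 0.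
  by have [|z zr lz] := hR l; [rewrite mem_iota|exists z].
suff yw : y j = w j.
  by rewrite distrC -yw (lt_le_trans (hy j jM).2).
apply: sep => // [l lM|]; first exact: (hy l lM).1.
rewrite -/tau0.
have -> : \sum_(j < M) s0 j * y j - tau0 =
   \sum_(j < M) s0 j * (y j - q t j) + (A t - tau0).
  under [X in _ = X + _]eq_bigr do rewrite mulrBr.
  by rewrite sumrB /A; ring.
rewrite [ltRHS]splitr (le_lt_trans (ler_normD _ _)) // ler_ltD //.
rewrite (le_trans (ler_norm_sum _ _ _)) //.
apply: (@le_trans _ _ (\sum_(j < M) `|s0 j| * c)).
  by apply: ler_sum => l _; rewrite normrM ler_wpM2l // ltW // (hy l (ltn_ord l)).2.
rewrite -mulr_suml; apply: (@le_trans _ _ (S * c)).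
  by apply: ler_wpM2r; [exact: ltW|rewrite /S lerDr].
by rewrite mulrC -ler_pdivlMr.
Qed.

Lemma fibre_curve_selection w :
  (forall P, pfun M P -> (forall e, P (phi^~ e) = 0) -> P w = 0) ->
  exists (t1 : R) (q : R -> nat -> C), [/\ 0 < t1,
    forall t, 0 < t <= t1 -> exists e, forall j, (j < M)%N -> q t j = phi j e,
    forall j, (j < M)%N -> cts_on `]0, t1]%classic (q^~ j) &
    forall j, (j < M)%N -> tends (0^'+) (q^~ j) (w j)].
Proof. by move=> hw; apply: limit_curve => s; apply: hw (equ_pfun s) (equ_cone s). Qed.

End FibrePolynomial.

Lemma incidence_curve_selection w :
  (forall P, pfun M P -> (forall e, P (phi^~ e) = 0) -> P w = 0) ->
  exists (t1 : R) (q : R -> nat -> C), [/\ 0 < t1,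
    forall t, 0 < t <= t1 -> exists e, forall j, (j < M)%N -> q t j = phi j e,
    forall j, (j < M)%N -> cts_on `]0, t1]%classic (q^~ j) &
    forall j, (j < M)%N -> tends (0^'+) (q^~ j) (w j)].
Proof.
have [F [h [F1 h0 vF rF]]] := generic_hypersurface psi_pfun K_ge0 psi_bound psi_dense.
exact: (fibre_curve_selection F1 h0 vF rF).
Qed.

End Incidence.

Lemma curve_selection w :
  (forall P, pfun M P -> (forall e, P (phi^~ e) = 0) -> P w = 0) ->
  exists (t1 : R) (q : R -> nat -> C), [/\ 0 < t1,
    forall t, 0 < t <= t1 -> exists e, forall j, (j < M)%N -> q t j = phi j e,
    forall j, (j < M)%N -> cts_on `]0, t1]%classic (q^~ j) &
    forall j, (j < M)%N -> tends (0^'+) (q^~ j) (w j)].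
Proof.
have [m [a [[K K0 hK] dense]]] := noether_projection.
exact: (incidence_curve_selection K0 hK dense).
Qed.

End CurveSelection.

(** * Border rank strata *)

Section Paths.
Variables (R : realType) (T : topologicalType).

Definition joined (S : set T) (x y : T) : Prop := exists gamma : R -> T,
  [/\ {within `[0, 1], continuous gamma}, gamma 0 = x, gamma 1 = y &
      forall t, 0 <= t <= 1 -> S (gamma t)].

Lemma within_comp (A B : set R) (u : R -> R) (f : R -> T) :
  continuous u -> (forall t, A t -> B (u t)) ->
  {within B, continuous f} -> {within A, continuous (f \o u)}.
Proof.
move=> cu uAB /subspace_continuousP cf; apply/subspace_continuousP => t At P hP.
have := cf _ (uAB t At) P hP; rewrite /within /= => h.
have {}h : \forall s \near t, B (u s) -> P (f (u s)) by apply: (cu t _ h).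
by apply: filterS h => s hs /uAB /hs.
Qed.

Lemma joined_sym S x y : joined S x y -> joined S y x.
Proof.
move=> [f [cf f0 f1 fS]]; exists (f \o (fun t => 1 - t)); split.
- apply: (within_comp _ _ cf) => [t|t /=].
    by apply: cvgB; [exact: cvg_cst|exact: cvg_id].
  by rewrite !in_itv /= => /andP[h1 h2]; rewrite subr_ge0 h2 gerBl.
- by rewrite /= subr0.
- by rewrite /= subrr.
- by move=> t /andP[h1 h2]; apply: fS; rewrite subr_ge0 h2 gerBl.
Qed.

Lemma joined_trans S x y z : joined S x y -> joined S y z -> joined S x z.
Proof.
move=> [f [cf f0 f1 fS]] [g [cg g0 g1 gS]].
pose h t := if t <= 1 / 2 then f (2 * t) else g (2 * t - 1).
have cl (a : R) : continuous (fun t : R => 2 * t - a).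
  move=> t; apply: cvgB; last exact: cvg_cst.
  by apply: cvgM; [exact: cvg_cst|exact: cvg_id].
exists h; split.
- have -> : `[0, 1]%classic = `[0, 1 / 2]%classic `|` `[1 / 2, 1]%classic :> set R.
    apply/seteqP; split=> t /=; rewrite !in_itv /=.
      by move=> /andP[p q]; have [s|/ltW s] := leP t (1 / 2); [left|right]; rewrite ?p ?q ?s.
    by case=> /andP[p q]; apply/andP; split; lra.
  apply: withinU_continuous; try exact: interval_closed.
    have c1 : {within `[0, 1 / 2], continuous (f \o (fun t => 2 * t - 0))}.
      apply: (within_comp (cl 0) _ cf) => t /=.
      by rewrite !in_itv /= => /andP[p q]; apply/andP; split; lra.
    apply: subspace_eq_continuous c1 => t; rewrite inE /= in_itv /= => /andP[_ p].
    by rewrite /from_subspace /h p /= subr0.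
  have c2 : {within `[1 / 2, 1], continuous (g \o (fun t => 2 * t - 1))}.
    apply: (within_comp (cl 1) _ cg) => t /=.
    by rewrite !in_itv /= => /andP[p q]; apply/andP; split; lra.
  apply: subspace_eq_continuous c2 => t; rewrite inE /= in_itv /= => /andP[p _].
  rewrite /from_subspace /h /=; case: leP => // q.
  have -> : t = 1 / 2 by apply/le_anti; rewrite p q.
  by rewrite (_ : 2 * (1 / 2) = 1) ?subrr ?f1 ?g0 //; field.
- by rewrite /h mulr0 divr_ge0.
- rewrite /h (_ : (1 <= 1 / 2 :> R) = false); last by apply/negbTE; rewrite -ltNge; lra.
  by rewrite (_ : 2 * 1 - 1 = 1 :> R) //; ring.
- move=> t /andP[p q]; rewrite /h; case: leP => s.
    by apply: fS; apply/andP; split; lra.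
  by apply: gS; apply/andP; split; lra.
Qed.

End Paths.

Lemma ptws_cvg (I : Type) (V : topologicalType) (F : set_system {ptws I -> V})
    (f : {ptws I -> V}) :
  Filter F -> (forall i, (fun g : {ptws I -> V} => g i) @ F --> f i) -> F --> f.
Proof.
move=> FF h; apply/cvg_sup => i; apply/cvg_image.
  by rewrite eqEsubset; split=> v // _; exists (cst v).
move=> W /h Q; exists (@^~ i @^-1` W) => //.
by rewrite eqEsubset; split => [j [? + <-//]|j Wj]; exists (fun _ => j).
Qed.

Section Tensors.
Variables (R : realType) (W : vectType R[i]) (d : nat).
Local Notation C := R[i].
Local Notation m := (\dim {:W}).
Local Notation I := {ffun 'I_d -> 'I_m}.
Local Notation tensor := (tensor W d).
Hypothesis d_gt0 : (0 < d)%N.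

Definition close (e : C) (A B : tensor) := forall k, `|B k - A k| < e.

Lemma nbhs_tensorP (A : tensor) (U : set tensor) :
  nbhs A U <-> exists2 e : C, 0 < e & forall B, close e A B -> U B.
Proof.
split; last first.
  move=> [e e0 h].
  have FA : Filter (nbhs A) by exact: nbhs_filter.
  have hk k : nbhs A [set B : tensor | `|B k - A k| < e].
    have := @proj_continuous _ (fun _ : I => R[i]^o) k A.
    move=> /cvgrPdist_lt/(_ e e0).
    by apply: filterS => B /=; rewrite distrC.
  have := near_all_seq (s := enum {: I}) FA (fun k _ => hk k).
  by apply: filterS => B hB; apply: h => k; apply: hB; rewrite mem_enum.
pose F : set_system tensor := fun U =>
  exists2 e : C, 0 < e & forall B, close e A B -> U B.
have FF : Filter F.
  split; first by exists 1.
    move=> P Q [d1 d10 h1] [d2 d20 h2]; have [c [c0 c1 c2]] := pos_min d10 d20.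
    exists c => // B hB; split; [apply: h1|apply: h2] => k.
      exact: lt_le_trans c1.
    exact: lt_le_trans c2.
  by move=> P Q PQ [e e0 h]; exists e => // B /h /PQ.
have cF : F --> A.
  apply: ptws_cvg => k; apply/cvgrPdist_lt => e e0.
  by exists e => // B hB /=; rewrite distrC; apply: hB.
by move=> /cF.
Qed.

Lemma closure_tensorP (S : set tensor) (A : tensor) :
  closure S A <-> forall e : C, 0 < e -> exists2 B, S B & close e A B.
Proof.
split=> [cA e e0|h U /nbhs_tensorP[e e0 hU]].
  have [|B [SB AB]] := cA (close e A); last by exists B.
  by apply/nbhs_tensorP; exists e.
by have [B SB /hU UB] := h e e0; exists B.
Qed.

Lemma cts_tensor (A : set R) (f : R -> tensor) :
  (forall k, cts_on A (fun t => f t k)) -> {within A, continuous f}.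
Proof.
move=> cf; apply/subspace_continuousP => t At U /nbhs_tensorP[e e0 hU].
have WF : Filter (within A (nbhs t)) by apply: within_filter.
have := near_all_seq (s := enum {: I}) WF (fun k _ => cf k t At e e0).
by apply: filterS => s h; apply: hU => k; apply: h; rewrite mem_enum.
Qed.

(** * Sums of powers and the filtration by border rank *)

Definition psum (s : nat) (v : nat -> W) : tensor :=
  fun k => \sum_(i < s) @tpow R W d (v i) k.

Definition psums (s : nat) : set tensor := [set A | exists v, A = psum s v].

Lemma sum_of_powersP A s : sum_of_powers A s <-> psums s A.
Proof.
split=> [[v ->]|[v ->]]; last by exists (fun i => v i).
exists (fun i => if insub i is Some j then v j else 0).
apply: funext => k; apply: eq_bigr => i _; by rewrite valK.
Qed.

Lemma psum_ext s v v' : (forall i, (i < s)%N -> v i = v' i) -> psum s v = psum s v'.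
Proof. by move=> h; apply: funext => k; apply: eq_bigr => i _; rewrite h. Qed.

Lemma psumS s v k : psum s.+1 v k = psum s v k + @tpow R W d (v s) k.
Proof. by rewrite /psum big_ord_recr. Qed.

Lemma tpow0 k : @tpow R W d 0 k = 0.
Proof.
by rewrite /tpow /tprod (bigD1 (Ordinal d_gt0)) //= linear0 mul0r.
Qed.

Lemma psumsS s : psums s `<=` psums s.+1.
Proof.
move=> _ [v ->]; exists (fun i => if (i < s)%N then v i else 0).
apply: funext => k; rewrite psumS ltnn tpow0 addr0.
by congr (_ k); apply: psum_ext => i ->.
Qed.

Lemma psums_mono s s' : (s <= s')%N -> psums s `<=` psums s'.
Proof.
move=> /subnKC <-; elim: (s' - s)%N => [|n IHn]; first by rewrite addn0.
by rewrite addnS => A /IHn /psumsS.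
Qed.

Lemma psum_sym s v : sym_tensor (psum s v).
Proof.
move=> p k; apply: eq_bigr => i _; rewrite /tpow /tprod.
rewrite [RHS](reindex_inj (@perm_inj _ p)); apply: eq_bigr => j _.
by rewrite ffunE.
Qed.

Lemma sym_rank_leE s : sym_rank_le s = psums s.
Proof.
apply/seteqP; split=> A.
  by move=> [_ [s' [/sum_of_powersP h _] le]]; apply: (psums_mono le).
move=> hA; split; first by case: hA => v ->; apply: psum_sym.
pose P n := `[< psums n A >].
have exP : exists n, P n by exists s; apply/asboolP.
case: (ex_minnP exP) => n /asboolP hn minn; exists n.
  split; first by apply/sum_of_powersP.
  by move=> n' /sum_of_powersP h; apply: minn; apply/asboolP.
by apply: minn; apply/asboolP.
Qed.

(** Symmetry is a closed condition, so limits of sums of powers are symmetric. *)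
Lemma sym_rank_closureE s : sym_rank_closure s = closure (psums s).
Proof.
rewrite /sym_rank_closure sym_rank_leE; apply/seteqP; split=> [A []//|A hA].
split => // p k; apply/eqP; rewrite -subr_eq0 -normr_eq0.
apply: contrapT => /negP n0.
have e0 : 0 < `|A [ffun i => k (p i)] - A k| / 2.
  by rewrite divr_gt0 // lt0r n0 normr_ge0.
have [B [v eB] hB] := (closure_tensorP _ _).1 hA _ e0.
have := psum_sym s v p k; rewrite -eB => sB.
suff : `|A [ffun i => k (p i)] - A k| < `|A [ffun i => k (p i)] - A k| by rewrite ltxx.
have -> : A [ffun i => k (p i)] - A k =
  (B k - A k) - (B [ffun i => k (p i)] - A [ffun i => k (p i)]) by rewrite sB; ring.
rewrite (le_lt_trans (ler_normB _ _)) //.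
have -> : (B k - A k) - (B [ffun i => k (p i)] - A [ffun i => k (p i)]) =
  A [ffun i => k (p i)] - A k by rewrite sB; ring.
by rewrite [ltRHS]splitr ltrD.
Qed.

Lemma closure_psums_mono s s' : (s <= s')%N ->
  closure (psums s) `<=` closure (psums s').
Proof. by move=> le; apply: closure_subset; apply: psums_mono. Qed.

Lemma border_rankE r A :
  (sym_tensor A /\ is_sym_border_rank A r.+1) <->
  (closure (psums r.+1) A /\ ~ closure (psums r) A).
Proof.
rewrite /is_sym_border_rank /is_least; split.
  move=> [_ []]; rewrite sym_rank_closureE => hA mn; split => // h.
  by have := mn r; rewrite sym_rank_closureE ltnn => /(_ h).
move=> [hA nA]; have sA : sym_tensor A.
  by move: hA; rewrite -sym_rank_closureE => -[].
split => //; split; first by rewrite sym_rank_closureE.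
move=> s; rewrite sym_rank_closureE ltnNge => hs; apply/negP => le; apply: nA.
exact: (closure_psums_mono le hs).
Qed.

Lemma closure_closure_psums (S : set tensor) r :
  S `<=` closure (psums r) -> closure S `<=` closure (psums r).
Proof.
move=> sub A /(closure_subset sub).
by rewrite -((closure_id _).1 (@closed_closure _ (psums r))).
Qed.

(** Approximate the first [s] powers by [r] powers; adding the next power gives [r.+1] powers, which
    are again approximated by [r]. *)
Lemma closure_psums_stable r : closure (psums r.+1) `<=` closure (psums r) ->
  forall s, closure (psums s) `<=` closure (psums r).
Proof.
move=> sub s; apply: closure_closure_psums; elim: s => [|s IHs] A.
  by move=> h; apply: subset_closure; apply: (psums_mono (leq0n r)).
move=> [v ->]; apply/closure_tensorP => e e0.
have e2 : 0 < e / 2 by rewrite divr_gt0.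
have [B [u ->] hB] : exists2 B, psums r B & close (e / 2) (psum s v) B.
  by apply: (closure_tensorP _ _).1 _ e2; apply: IHs; exists v.
pose u' i := if (i < r)%N then u i else v s.
have [B' B'r hB'] : exists2 B', psums r B' & close (e / 2) (psum r.+1 u') B'.
  by apply: (closure_tensorP _ _).1 _ e2; apply: sub; apply: subset_closure; exists u'.
exists B' => // k.
have e1 : psum r.+1 u' k = psum r u k + @tpow R W d (v s) k.
  rewrite psumS /u' ltnn; congr (_ + _).
  by rewrite -(@psum_ext r u) // => i ->.
have -> : B' k - psum s.+1 v k =
    (B' k - psum r.+1 u' k) + (psum r u k - psum s v k).
  by rewrite e1 psumS; ring.
by rewrite [ltRHS]splitr (le_lt_trans (ler_normD _ _)) // ltrD.
Qed.

(** * Polynomial coordinates on tensors *)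

Local Notation M := #|{: I}|.
Hypothesis m_gt0 : (0 < m)%N.

(** The coordinates of the i-th vector occupy the i-th block of length [m] in [e]. *)
Definition tcoord s (k : I) (e : nat -> C) : C :=
  \sum_(i < s) \prod_(l < d) e (i * m + k l)%N.

Definition ten s (e : nat -> C) : tensor := fun k => tcoord s k e.

Definition flat (A : tensor) (j : nat) : C :=
  if insub j is Some o then A (enum_val (o : 'I_M)) else 0.

Lemma flat_rank A k : flat A (enum_rank k) = A k.
Proof. by rewrite /flat valK enum_rankK. Qed.

Lemma flatE A j (jM : (j < M)%N) : flat A j = A (enum_val (Ordinal jM)).
Proof. by rewrite /flat insubT. Qed.

Lemma psums_ten s A : psums s A <-> exists e, A = ten s e.
Proof.
have fr : free (vbasis {:W}) := basis_free (vbasisP _).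
split=> [[v ->]|[e ->]].
  exists (fun n => if insub (n %% m)%N is Some c then
    coord (vbasis {:W}) c (v (n %/ m)%N) else 0).
  apply: funext => k; apply: eq_bigr => i _; apply: eq_bigr => l _.
  by rewrite modnMDl modn_small // valK divnMDl // divn_small // addn0.
exists (fun i => \sum_(c < m) e (i * m + c)%N *: (vbasis {:W})`_c).
apply: funext => k; apply: eq_bigr => i _; apply: eq_bigr => l _.
by rewrite (coord_sum_free (fun c : 'I_m => e (i * m + c)%N)).
Qed.

Lemma psums_ten_self s e : psums s (ten s e).
Proof. by apply/psums_ten; exists e. Qed.

Lemma flat_ten_pfun s j : pfun (s * m) (fun e => flat (ten s e) j).
Proof.
have [jM|Mj] := ltnP j M; last first.
  by apply: (pfun_eq (Pconst _ 0)) => e; rewrite /flat insubF // ltnNge Mj.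
have h : pfun (s * m) (tcoord s (enum_val (Ordinal jM))).
  apply: pfun_sum => i _; apply: pfun_prod => l _; apply: Pvar.
  rewrite -ltn_subRL (leq_trans (ltn_ord _)) // -mulnBl leq_pmull //.
  by rewrite subn_gt0.
by apply: (pfun_eq h) => e; rewrite flatE.
Qed.

(** Scaling every vector by a d-th root of [c] scales the tensor by [c]. *)
Lemma flat_ten_cone s e c : exists e', forall j, (j < M)%N ->
  flat (ten s e') j = c * flat (ten s e) j.
Proof.
exists (fun n => d.-root c * e n) => j jM; rewrite !flatE /ten /tcoord mulr_sumr.
apply: eq_bigr => i _; rewrite big_split /= prodr_const card_ord.
by rewrite rootCK.
Qed.

Lemma vanish_closure s A (P : (nat -> C) -> C) : closure (psums s) A ->
  pfun M P -> (forall e, P (flat (ten s e)) = 0) -> P (flat A) = 0.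
Proof.
move=> /closure_tensorP hA pP vP.
pose F : set_system tensor := fun U =>
  exists2 e : C, 0 < e & forall B, close e A B -> psums s B -> U B.
have FF : ProperFilter F.
  split; first by move=> [e e0 h]; have [B Bs AB] := hA e e0; apply: (h B).
  split; first by exists 1.
    move=> U V [d1 d10 h1] [d2 d20 h2]; have [c [c0 c1 c2]] := pos_min d10 d20.
    exists c => // B hB Bs; split; [apply: h1|apply: h2] => // k.
      exact: lt_le_trans c1.
    exact: lt_le_trans c2.
  by move=> U V UV [e e0 h]; exists e => // B hB /(h B hB) /UV.
have tF : tends F (fun B => P (flat B)) (P (flat A)).
  apply: (tends_pfun _ pP) => i iM e e0; exists e => // B hB _ /=.
  by rewrite !flatE.
apply: (tends_dominated FF (lexx 0) tF (tends_cst _ 0)).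
exists 1 => // B _ /psums_ten[e ->] /=.
by rewrite vP normr0 mul0r.
Qed.

Lemma separating_polynomial s A : ~ closure (psums s) A ->
  exists P, [/\ pfun M P, forall e, P (flat (ten s e)) = 0 & P (flat A) != 0].
Proof.
move=> nA; apply: contrapT => nP; apply: nA.
have [|t1 [q [t10 hq _ lq]]] := @curve_selection R (s * m) M
    (fun j e => flat (ten s e) j) (fun j _ => flat_ten_pfun s j)
    (flat_ten_cone s) (flat A).
  move=> P pP vP; apply: contrapT => /eqP PA; apply: nP.
  by exists P.
apply/closure_tensorP => e e0.
have FR : ProperFilter (0^'+ : set_system R) by apply: at_right_proper_filter.
have nearq : 0^'+ [set t : R | forall k, k \in enum {: I} ->
    `|q t (enum_rank k) - A k| < e].
  apply: near_all_seq => k _.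
  by have := lq _ (ltn_ord (enum_rank k)) e e0; rewrite flat_rank.
have near_t1 : 0^'+ [set t : R | 0 < t <= t1].
  rewrite /at_right /within /=; apply/near_dist; exists t1 => // t.
  by rewrite subr0 => tt1 t0; rewrite t0 -(gtr0_norm t0) ltW.
have [t [/= h /hq[x hx]]] := filter_ex (filterI nearq near_t1).
exists (ten s x); first exact: psums_ten_self.
by move=> k; rewrite -flat_rank -hx // h // mem_enum.
Qed.

(** * Paths inside a border rank stratum *)

Definition stratum r : set tensor :=
  [set A | closure (psums r.+1) A /\ ~ closure (psums r) A].

Lemma joined_to_psum r A : stratum r A ->
  exists2 e, stratum r (ten r.+1 e) & joined R (stratum r) A (ten r.+1 e).
Proof.
move=> [hA nA].
have [P pP vP|t1 [q [t10 hq cq lq]]] := @curve_selection R (r.+1 * m) M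
    (fun j e => flat (ten r.+1 e) j) (fun j _ => flat_ten_pfun r.+1 j)
    (flat_ten_cone r.+1) (flat A).
  exact: (vanish_closure hA).
have [e e0 he] : exists2 e : C, 0 < e & forall B, psums r B -> ~ close e A B.
  apply: contrapT => h; apply: nA; apply/closure_tensorP => e e0.
  apply: contrapT => h'; apply: h; exists e => // B Br AB; apply: h'.
  by exists B.
(* The curve is kept within e / 2 of [A]: were one of its points in the smaller closure, an
   approximation of it by [r] powers to within e / 2 would be closer than [e] to [A]. *)
have e2 : 0 < e / 2 by rewrite divr_gt0.
have FR : ProperFilter (0^'+ : set_system R) by apply: at_right_proper_filter.
have nearq : 0^'+ [set t : R | forall k, k \in enum {: I} ->
    `|q t (enum_rank k) - A k| < e / 2].
  apply: near_all_seq => k _.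
  by have := lq _ (ltn_ord (enum_rank k)) _ e2; rewrite flat_rank.
have [d' d'0 hd'] := (near_dist _ _).1 nearq.
pose dl := Num.min t1 (d' / 2).
have dl0 : 0 < dl by rewrite lt_min t10 divr_gt0.
have dl1 (t : R) : 0 < t <= 1 -> 0 < dl * t <= t1.
  move=> /andP[p p']; rewrite mulr_gt0 //=.
  by rewrite (@le_trans _ _ dl) ?ge_min ?lexx // ler_piMr // ltW.
have dl2 (t : R) k : 0 < t <= 1 -> `|q (dl * t) (enum_rank k) - A k| < e / 2.
  move=> ht; have /andP[p _] := dl1 t ht; apply: hd' => //; last by rewrite mem_enum.
  rewrite subr0 gtr0_norm //; case/andP: ht => _ t1'.
  rewrite (@le_lt_trans _ _ dl) ?ler_piMr ?(ltW dl0) //.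
  by rewrite gt_min ltr_pdivrMr // ltr_pMr // ltr1n orbT.
have qten (t : R) : 0 < t <= 1 -> exists x,
    (fun k => q (dl * t) (enum_rank k)) = ten r.+1 x.
  move=> /dl1 /hq[x hx]; exists x; apply: funext => k.
  by rewrite hx // flat_rank.
have qS (t : R) : 0 < t <= 1 -> stratum r (fun k => q (dl * t) (enum_rank k)).
  move=> ht; split.
    by have [x ->] := qten t ht; apply: subset_closure; apply: psums_ten_self.
  move=> /closure_tensorP/(_ _ e2)[B Br hB]; apply: (he B Br) => k.
  rewrite -[B k](subrK (q (dl * t) (enum_rank k))) -addrA.
  rewrite [ltRHS]splitr (le_lt_trans (ler_normD _ _)) // ltrD //.
  exact: dl2.
have h1 : 0 < (1 : R) <= 1 by rewrite ltr01 lexx.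
have [x ex] := qten 1 h1.
exists x; first by rewrite -ex; apply: qS.
exists (fun t => if t <= 0 then A else fun k => q (dl * t) (enum_rank k)); split.
- apply: cts_tensor => k t; rewrite /= in_itv /= => /andP[t0 t1'] eps eps0.
  have [t00|t00] := leP t 0.
    have te : t = 0 by apply/le_anti; rewrite t0 t00.
    rewrite te; have := lq _ (ltn_ord (enum_rank k)) _ eps0.
    rewrite flat_rank => /near_dist[eta eta0 heta].
    rewrite /within /=; apply/near_dist; exists (eta / dl); first by rewrite divr_gt0.
    move=> s sd _ /=; case: leP => s0; first by rewrite subrr normr0.
    apply: heta; last by rewrite mulr_gt0.
    rewrite subr0 gtr0_norm ?mulr_gt0 // mulrC -ltr_pdivlMr //.
    by rewrite subr0 gtr0_norm in sd.
  have tin : 0 < t <= 1 by rewrite t00.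
  have := cq _ (ltn_ord (enum_rank k)) (dl * t); rewrite /= in_itv /= => /(_ (dl1 t tin) _ eps0).
  rewrite /within /= => /near_dist[eta eta0 heta].
  have lts : \forall s \near t, 0 < s by apply: lt_nbhsr.
  have nts : \forall s \near t, `|s - t| < eta / dl.
    by apply/near_dist; exists (eta / dl) => //; rewrite divr_gt0.
  apply: filterS (filterI lts nts) => s [s0 sd]; rewrite in_itv /= => /andP[_ s1].
  rewrite leNgt s0 /=; apply: heta; last by rewrite in_itv /= dl1 // s0.
  by rewrite -mulrBr normrM gtr0_norm // mulrC -ltr_pdivlMr.
- by rewrite lexx.
- by rewrite leNgt ltr01 /= ex.
- move=> t /andP[t0 t1']; case: leP => // t00; apply: qS.
  by rewrite t00.
Qed.

Lemma exists_avoiding (s : seq C) (g : C -> R) : exists y, forall z, z \in s -> g z != y.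
Proof.
exists (1 + \sum_(z <- s) `|g z|) => z zs; rewrite lt_eqF //.
rewrite (big_rem z zs) /= addrCA (le_lt_trans (ler_norm _)) // ltrDl.
by rewrite ltr_wpDr // sumr_ge0.
Qed.

(* On the complex line through two parameter points the bad parameters are among
   the roots of a nonzero polynomial; a parabola from 0 to 1 avoids them. *)
Lemma joined_psums r e e' : stratum r (ten r.+1 e) -> stratum r (ten r.+1 e') ->
  joined R (stratum r) (ten r.+1 e) (ten r.+1 e').
Proof.
move=> [he ne] he'.
have [P [pP vP nP]] := separating_polynomial ne.
pose ln (z : C) (i : nat) : C := e i + z * (e' i - e i).
have ln_pfun N i : pfun N.+1 (fun z => ln (z 0%N) i).
  by apply: Padd; [|apply: Pmul]; [exact: Pconst|exact: Pvar|exact: Pconst].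
have lnf j : pfun 1 (fun z => flat (ten r.+1 (ln (z 0%N))) j).
  apply: (pfun_comp (flat_ten_pfun r.+1 j) (g := fun i z => ln (z 0%N) i)) => i _.
  exact: ln_pfun.
have [p hp] : exists p : {poly C}, forall z, P (flat (ten r.+1 (ln z))) = p.[z].
  apply: (@pfun_poly _ (fun z => P (flat (ten r.+1 (ln (z 0%N)))))).
  by apply: (pfun_comp pP (g := fun j z => flat (ten r.+1 (ln (z 0%N))) j)).
have ln0 : ln 0 = e by apply: funext => i; rewrite /ln mul0r addr0.
have ln1 : ln 1 = e' by apply: funext => i; rewrite /ln mul1r addrC subrK.
have p0 : p != 0.
  by apply: contraNneq nP => z; rewrite -ln0 hp z horner0.
have [rs ers] := closed_field_poly_normal p.
have good z : z \notin rs -> stratum r (ten r.+1 (ln z)).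
  move=> zrs; split; first by apply: subset_closure; apply: psums_ten_self.
  move=> /(vanish_closure)/(_ pP vP); rewrite hp => /rootP.
  by rewrite ers rootZ ?lead_coef_eq0 // root_prod_XsubC (negPf zrs).
(* A root on the parabola Im = y Re (1 - Re), with Re different from 0 and 1, would have this
   quotient equal to [y]. *)
have [y hy] := exists_avoiding rs
  (fun z => complex.Im z / (complex.Re z * (1 - complex.Re z))).
pose zt (t : R) : C := t%:C + 'i * (y * (t * (1 - t)))%:C.
have ztE t : zt t = Complex t (y * (t * (1 - t))).
  by rewrite /zt; simpc.
exists (fun t => ten r.+1 (ln (zt t))); split.
- apply: cts_tensor => k t _.
  have FT : Filter (nbhs t) by exact: nbhs_filter.
  have tr : tends (nbhs t) (fun s : R => s%:C) t%:C := tends_real t.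
  have tz : tends (nbhs t) zt (zt t).
    have -> : zt = fun s => s%:C + 'i * (y%:C * (s%:C * (1 - s%:C))).
      by apply: funext => s; rewrite /zt !rmorphM rmorphB.
    apply: tendsD => //; apply: tendsM; first exact: tends_cst.
    apply: tendsM; first exact: tends_cst.
    by apply: tendsM => //; apply: tendsB => //; apply: tends_cst.
  move=> eps eps0; rewrite /within /=.
  have := tends_pfun (g := fun s _ => zt s) FT (lnf (enum_rank k)) (fun _ _ => tz) eps0.
  by apply: filterS => s /= h _; rewrite !flat_rank in h.
- by rewrite /zt mul0r mulr0 mulr0 addr0 ln0.
- by rewrite /zt subrr !mulr0 addr0 ln1.
(* The endpoints lie in the stratum by hypothesis; [P] may well vanish at the second one. *)
move=> t /andP[t0 t1]; have [->|tn0] := eqVneq t 0.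
  by rewrite /zt mul0r mulr0 mulr0 addr0 ln0.
have [->|tn1] := eqVneq t 1.
  by rewrite /zt subrr !mulr0 addr0 ln1.
apply: good; rewrite ztE; apply/negP => /hy /=.
by rewrite mulfK ?eqxx // mulf_neq0 // subr_eq0 eq_sym.
Qed.

Lemma stratum_path_connected r g : is_generic_sym_rank W d g -> (r.+1 <= g)%N ->
  path_connected R (stratum r).
Proof.
move=> [gen mn] rg; split.
  apply: contrapT => ns.
  (* An empty stratum would stop the growth of the closures at [r], so [r] powers would already be
     dense in the symmetric tensors, against the minimality of [g]. *)
  have sub : closure (psums r.+1) `<=` closure (psums r).
    by move=> A hA; apply: contrapT => nA; apply: ns; exists A.
  suff /mn : sym_rank_closure r = sym_tensor (W := W) (d := d) by rewrite leqNgt rg.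
  apply/seteqP; split=> [A []//|A]; rewrite -gen !sym_rank_closureE.
  exact: closure_psums_stable.
move=> A B /joined_to_psum[e he Ae] /joined_to_psum[e' he' Be'].
apply: joined_trans Ae _; apply: joined_trans (joined_psums he he') _.
exact: joined_sym.
Qed.

End Tensors.

Theorem corollary3p3 (R : realType) (d : nat) (W : vectType R[i]) (g r : nat) :
  (0 < d)%N ->
  (2 <= \dim {:W})%N ->
  is_generic_sym_rank W d g ->
  (0 < r)%N ->
  (r <= g)%N ->
  path_connected R
    [set A : tensor W d | sym_tensor A /\ is_sym_border_rank A r].
Proof.
case: r => // r d0 dimW gen _ rg.
have -> : [set A : tensor W d | sym_tensor A /\ is_sym_border_rank A r.+1] =
    stratum r.
  by apply/seteqP; split=> A /(border_rankE d0).
exact: (stratum_path_connected d0 (ltnW dimW) gen rg).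
Qed.
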